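(* Let $Z$ be an infinite field, let $D$ be a finite-dimensional division algebra over its centre $Z$, and let $D(X)$ be the division ring of rational functions in several variables $u_1,\ldots,u_q$ over $D$, with centre $Z(X) = Z(u_1,\ldots,u_q)$. (1) One has $[D(X):Z(X)] = [D:Z]$ and $\mathrm{Exp}\, D(X) = \mathrm{Exp}\, D$. (2) $D(X)$ has a maximal subfield which is Galois over $Z(X)$ if and only if $D$ has a maximal subfield which is Galois over $Z$. (3) Suppose $\mathrm{char}(Z) = p > 0$. Then $D(X)$ has a maximal subfield which is purely inseparable of exponent $r$ over $Z(X)$ if and only if $D$ has a maximal subfield which is purely inseparable of exponent $r$ over $Z$. Likewise, $D(X)$ has a maximal subfield which is Galois over $Z(X)$ with Galois group isomorphic to $(\mathbb{Z}/p\mathbb{Z})^r$ if and only if $D$ has a maximal subfield which is Galois over $Z$ with Galois group isomorphic to $(\mathbb{Z}/p\mathbb{Z})^r$.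
   Context: $Z[X] = Z[u_1,\ldots,u_q]$ is a polynomial ring and $Z(X)$ its fraction field. $D(X)$ is the skewfield of fractions of $D[X] := D \otimes_Z Z[X]$; one has $D(X) \simeq D \otimes_Z Z(X)$, with centre $Z(X)$. A (commutative) subfield $F$ of a division ring $R$ is maximal if its centralizer $C_R(F)$ equals $F$. The exponent $\mathrm{Exp}(R)$ of a central simple algebra $R$ with centre $C$ is the order of the class of $R$ in the Brauer group of $C$, i.e. the smallest integer $n \geq 1$ such that $R^{\otimes n}$ (tensor power over $C$) is isomorphic to a matrix algebra $M_N(C)$. A purely inseparable finite extension $E/F$ in characteristic $p$ has exponent $r$ if $r\ge 0$ is the smallest integer with $x^{p^r} \in F$ for all $x \in E$. *)

(* Defs.v *)
From HB Require Import structures.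
From mathcomp Require Export all_boot all_order all_fingroup all_algebra.
From mathcomp Require Export all_solvable all_field sesquilinear.
From mathcomp.multinomials Require Export mpoly.

Set Implicit Arguments.
Unset Strict Implicit.
Unset Printing Implicit Defensive.

Local Open Scope ring_scope.

Definition infinite (T : eqType) : Prop := ~ exists s : seq T, forall x, x \in s.

Definition division_ring (R : unitRingType) : Prop :=
  forall x : R, x != 0 -> x \is a GRing.unit.

(* [V : F] = n, without presupposing that V is finite-dimensional. *)
Definition has_dim (F : fieldType) (V : lmodType F) (n : nat) : Prop :=
  exists b : 'I_n -> V,
    forall v : V, exists! c : {ffun 'I_n -> F}, v = \sum_(i < n) c i *: b i.

Definition alg_iso (F : fieldType) (A B : algType F) : Prop :=
  exists f : {lrmorphism A -> B}, bijective f.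

(* T, with the pure tensors a (x) b = t a b, is the tensor product of the
   F-algebras A and B. *)
Definition tensor_product (F : fieldType) (A B T : algType F)
    (t : {bilinear A -> B -> T}) : Prop :=
  [/\ forall (M : lmodType F) (g : {bilinear A -> B -> M}),
        exists2 h : {linear T -> M}, forall a b, h (t a b) = g a b
          & forall h' : {linear T -> M},
              (forall a b, h' (t a b) = g a b) -> h' =1 h,
      t 1 1 = 1
    & forall a a' b b', t a b * t a' b' = t (a * a') (b * b')].

Fixpoint tensor_power (F : fieldType) (A : algType F) (n : nat)
    (T : algType F) : Prop :=
  match n with
  | 0 => alg_iso T F^o
  | n'.+1 => exists (T' : algType F) (t : {bilinear T' -> A -> T}),
      tensor_power A n' T' /\ tensor_product t
  end.

(* The size n.+1 excludes the zero ring 'M[F]_0. *)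
Definition is_matrix_algebra (F : fieldType) (T : algType F) : Prop :=
  exists n : nat, alg_iso T 'M[F]_n.+1.

Definition tensor_power_splits (F : fieldType) (A : algType F) (n : nat) : Prop :=
  exists T : algType F, tensor_power A n T /\ is_matrix_algebra T.

Definition has_exponent (F : fieldType) (A : algType F) (n : nat) : Prop :=
  [/\ (0 < n)%N, tensor_power_splits A n
    & forall m, (0 < m)%N -> tensor_power_splits A m -> (n <= m)%N].

Definition commutative_subfield (R : unitRingType) (E : R -> Prop) : Prop :=
  [/\ E 1, forall x y, E x -> E y -> E (x - y),
      forall x y, E x -> E y -> E (x / y)
    & forall x y, E x -> E y -> GRing.comm x y].

Definition centralizer (R : unitRingType) (E : R -> Prop) (x : R) : Prop :=
  forall y, E y -> GRing.comm x y.

Definition maximal_subfield (R : unitRingType) (E : R -> Prop) : Prop :=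
  commutative_subfield E /\ forall x, centralizer E x <-> E x.

(* E, as an extension of the base field F of A, is a copy of L / F. *)
Definition is_copy_of (F : fieldType) (A : unitAlgType F) (E : A -> Prop)
    (L : fieldExtType F) : Prop :=
  exists f : {lrmorphism L -> A}, forall x, E x <-> exists y, x = f y.

Definition galois_subfield (F : fieldType) (A : unitAlgType F)
    (E : A -> Prop) : Prop :=
  exists L : splittingFieldType F, is_copy_of E L /\ galois 1%VS {:L}%VS.

(* (Z/pZ)^r is the additive group of row vectors over 'Z_p; this reading of 'Z_p
   is only correct for p > 1. *)
Definition elem_galois_subfield (p r : nat) (F : fieldType) (A : unitAlgType F)
    (E : A -> Prop) : Prop :=
  exists L : splittingFieldType F,
    [/\ is_copy_of E L, galois 1%VS {:L}%VS
      & 'Gal({:L} / 1) \isog [set: 'rV['Z_p]_r]].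

Definition insep_exponent (p r : nat) (F : fieldType) (L : fieldExtType F) : Prop :=
  (forall x : L, x ^+ (p ^ r) \in 1%VS) /\
  (forall s, (forall x : L, x ^+ (p ^ s) \in 1%VS) -> (r <= s)%N).

Definition purely_insep_subfield (p r : nat) (F : fieldType)
    (A : unitAlgType F) (E : A -> Prop) : Prop :=
  exists L : fieldExtType F,
    [/\ is_copy_of E L, purely_inseparable 1%VS {:L}%VS & insep_exponent p r L].

Definition has_maximal_subfield (F : fieldType) (A : unitAlgType F)
    (P : (A -> Prop) -> Prop) : Prop :=
  exists E : A -> Prop, maximal_subfield E /\ P E.

Definition ratfun (Z : fieldType) (q : nat) : fieldType :=
  {fraction {mpoly Z[q]}}.

(* D[X] = D (x)_Z Z[X] is {mpoly D[q]}, whose indeterminates are central.  The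
   Z(X)-algebra DX is the skewfield of fractions of D[X] via j; the last clause
   says that the scalars Z(X) of DX extend j on Z[X]. *)
Definition skewfield_of_fractions (Z : fieldType) (D : falgType Z) (q : nat)
    (DX : unitAlgType (ratfun Z q)) (j : {rmorphism {mpoly D[q]} -> DX}) : Prop :=
  [/\ division_ring DX, injective j,
      forall x : DX, exists a b : {mpoly D[q]}, b != 0 /\ x = j a / j b
    & forall f : {mpoly Z[q]},
        (FracField.tofrac f : ratfun Z q)%:A = j (map_mpoly (GRing.in_alg D) f)].

(* Main.v *)
(* Fix a basis of D over Z and its structure constants; j carries that basis to a
   basis of D(X) over Z(X) with the same structure constants.  Each property in the
   theorem then amounts to the solvability, over the ground field, of a finite
   system of polynomial equations whose coefficients are structure constants in Z.
   Solutions over Z are solutions over Z(X).  Conversely, as Z is infinite, there is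
   a point of Z^q where no denominator occurring in a given solution over Z(X)
   vanishes, and evaluation there gives a solution over Z.  Inequations and rank
   conditions become equations by adjoining certificates (one-sided inverses,
   elements pairing to 1). *)
From HB Require Import structures.
From Stdlib Require Import Classical_Prop.
From mathcomp Require Import ring.
Require Import Defs.

Set Implicit Arguments.
Unset Strict Implicit.
Unset Printing Implicit Defensive.

Import GRing.Theory VectorInternalTheory.
Local Open Scope ring_scope.

(** * Algebras in coordinates *)

(** The structure constants of a subfield of D(X) lie in Z(X) and not necessarily in Z, so they
    count among the unknowns and are specialized together with the embedding. Being a field is not
    among the equations: it is recovered afterwards, because the specialized algebra is commutative,
    finite-dimensional and embeds in a division ring. Galois theory is treated in the same way: only
    the action of a fixed abstract finite group is specialized, and Artin's theorem on fixed fields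
    gives back the Galois group. Evaluation at a point is defined on a part of Z(X) only, so
    solutions are moved along the graph of a partial ring homomorphism. The inclusion of Z in Z(X)
    is another such graph, hence both directions of each equivalence come from one transfer lemma.
    For the exponent, tensor powers get explicit structure constants, and the size of the matrix
    algebra stays fixed during the transfer. *)

Section StructureConstants.

Variables (R : comNzRingType) (n : nat) (C : 'I_n -> 'M[R]_n).
Implicit Types x y z : 'rV[R]_n.

(* Row j of C i holds the coordinates of the product of the basis vectors i and j. *)
Definition lmulmx x : 'M[R]_n := \sum_i x 0 i *: C i.
Definition rmulmx y : 'M[R]_n := \matrix_i (y *m C i).
Definition mulc x y : 'rV[R]_n := y *m lmulmx x.

Lemma mulc_rmulmx x y : x *m rmulmx y = mulc x y.
Proof.
rewrite /mulc /lmulmx mulmx_sumr mulmx_sum_row.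
by apply: eq_bigr => i _; rewrite rowK -scalemxAr.
Qed.

Lemma mulcDl x y z : mulc (x + y) z = mulc x z + mulc y z.
Proof. by rewrite -!mulc_rmulmx mulmxDl. Qed.

Lemma mulcDr x y z : mulc z (x + y) = mulc z x + mulc z y.
Proof. exact: mulmxDl. Qed.

Lemma mulcZl a x y : mulc (a *: x) y = a *: mulc x y.
Proof. by rewrite -!mulc_rmulmx scalemxAl. Qed.

Lemma mulcZr a x y : mulc x (a *: y) = a *: mulc x y.
Proof. by rewrite /mulc -scalemxAl. Qed.

Lemma mulc_suml (I : Type) (r : seq I) (P : pred I) (f : I -> 'rV_n) y :
  mulc (\sum_(i <- r | P i) f i) y = \sum_(i <- r | P i) mulc (f i) y.
Proof.
by rewrite -mulc_rmulmx mulmx_suml; apply: eq_bigr => i _; rewrite mulc_rmulmx.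
Qed.

Lemma mulc_sumr (I : Type) (r : seq I) (P : pred I) (f : I -> 'rV_n) x :
  mulc x (\sum_(i <- r | P i) f i) = \sum_(i <- r | P i) mulc x (f i).
Proof. by rewrite /mulc mulmx_suml. Qed.

Lemma mulc_delta i j : mulc (delta_mx 0 i) (delta_mx 0 j) = row j (C i).
Proof. by rewrite -mulc_rmulmx -rowE rowK -rowE. Qed.

Lemma mulcE x y : mulc x y = \sum_i x 0 i *: (y *m C i).
Proof. by rewrite /mulc mulmx_sumr; apply: eq_bigr => i _; rewrite scalemxAr. Qed.

Definition powc (u : 'rV[R]_n) x m := iter m (mulc x) u.

End StructureConstants.

Record unital_sc (F : fieldType) (n : nat) (C : 'I_n -> 'M[F]_n) (u : 'rV_n) :
  Prop := UnitalSc {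
    mulcA : associative (mulc C);
    mulc1l : left_id u (mulc C);
    mulc1r : right_id u (mulc C);
    mulc1_neq0 : u != 0 }.

(** An isomorphism of [A] with the algebra that [C] and [u] define on row vectors. The unit is kept
    as separate data because it is specialized along with [C]. *)
Record coords (F : fieldType) (A : algType F) (n : nat) (C : 'I_n -> 'M[F]_n)
    (u : 'rV[F]_n) := Coords {
  to_rV : {linear A -> 'rV[F]_n};
  of_rV : {linear 'rV[F]_n -> A};
  to_rVK : cancel to_rV of_rV;
  of_rVK : cancel of_rV to_rV;
  to_rVM : forall x y, to_rV (x * y) = mulc C (to_rV x) (to_rV y);
  to_rV1 : to_rV 1 = u }.

Section Coords.
Variables (F : fieldType) (A : algType F) (n : nat) (C : 'I_n -> 'M[F]_n).
Variables (u : 'rV[F]_n) (k : coords A C u).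

Lemma of_rVM x y : of_rV k (mulc C x y) = of_rV k x * of_rV k y.
Proof. by apply: (can_inj (to_rVK k)); rewrite to_rVM !of_rVK. Qed.

Lemma of_rV1 : of_rV k u = 1.
Proof. by have := to_rVK k 1; rewrite to_rV1. Qed.

Lemma of_rV_pow x m : of_rV k (powc C u x m) = of_rV k x ^+ m.
Proof. by elim: m => [|m IH]; rewrite ?of_rV1 // exprS -IH -of_rVM. Qed.

Lemma coords_unital : unital_sc C u.
Proof.
have inj := can_inj (of_rVK k).
split=> [x y z|x|x|]; try by apply: inj; rewrite !of_rVM ?of_rV1 ?mulrA ?mul1r ?mulr1.
by apply/eqP => /(congr1 (of_rV k)); rewrite of_rV1 linear0; apply/eqP/oner_neq0.
Qed.

End Coords.

(** The proof [h] is a parameter of the type so that the ring structure can be attached to this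
    alias of the row vectors. *)
Definition scalg (F : fieldType) (n : nat) (C : 'I_n -> 'M[F]_n) (u : 'rV[F]_n)
  (h : unital_sc C u) : Type := 'rV[F]_n.

Section ScAlg.
Variables (F : fieldType) (n : nat) (C : 'I_n -> 'M[F]_n) (u : 'rV[F]_n).
Variable h : unital_sc C u.
Local Notation S := (scalg h).

HB.instance Definition _ := Vector.on S.
HB.instance Definition _ := GRing.Zmodule_isNzRing.Build S
  (mulcA h) (mulc1l h) (mulc1r h) (fun x y z => mulcDl C x y z)
  (fun x y z => mulcDr C y z x) (mulc1_neq0 h).
Let scalerAl (a : F) (x y : S) : a *: (x * y) = (a *: x) * y.
Proof. exact/esym/mulcZl. Qed.
HB.instance Definition _ := GRing.Lmodule_isLalgebra.Build F S scalerAl.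
Let scalerAr (a : F) (x y : S) : a *: (x * y) = x * (a *: y).
Proof. exact/esym/mulcZr. Qed.
HB.instance Definition _ := GRing.Lalgebra_isAlgebra.Build F S scalerAr.
HB.instance Definition _ := Algebra_isFalgebra.Build F S.

Definition scalg_coords : coords S C u :=
  @Coords F S n C u (@idfun S : {linear S -> 'rV[F]_n}) (@idfun 'rV[F]_n : {linear 'rV[F]_n -> S})
    (fun _ => erefl) (fun _ => erefl) (fun _ _ => erefl) erefl.

End ScAlg.

Section FalgCoords.
Variables (F : fieldType) (A : falgType F).

Definition falg_sc (i : 'I_(dim A)) : 'M[F]_(dim A) :=
  \matrix_j v2r (r2v (delta_mx 0 i) * r2v (delta_mx 0 j) : A).

Lemma v2rM (x y : A) : v2r (x * y) = mulc falg_sc (v2r x) (v2r y).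
Proof.
rewrite -[x in LHS]v2rK -[y in LHS]v2rK.
rewrite (row_sum_delta (v2r x)) (row_sum_delta (v2r y)).
rewrite !linear_sum mulr_suml mulc_suml linear_sum; apply: eq_bigr => i _ /=.
rewrite mulc_sumr mulr_sumr linear_sum; apply: eq_bigr => j _ /=.
by rewrite mulcZl mulcZr mulc_delta rowK !linearZ /= -scalerAl -scalerAr !linearZ.
Qed.

Definition falg_coords : coords A falg_sc (v2r 1) :=
  Coords v2rK r2vK v2rM erefl.

End FalgCoords.

(** Right multiplication by [x] is an injective endomorphism of a finite-dimensional space, hence
    bijective, and [y] is the preimage of 1. *)
Lemma falg_unit (F : fieldType) (A : falgType F) (x : A) :
  (forall y, y * x = 0 -> y = 0) -> exists y, y * x = 1.
Proof.
move=> hx; pose f := amulr x.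
have kf : lker f == 0%VS.
  by apply/eqP/vspaceP => y; rewrite memv_ker memv0 lfunE /=; apply/eqP/eqP => [/hx|->] //; rewrite mul0r.
exists ((f^-1)%VF 1); have := lker0_lfunVK kf 1; by rewrite lfunE.
Qed.

Definition scfield (F : fieldType) (n : nat) (C : 'I_n -> 'M[F]_n) (u : 'rV[F]_n)
  (h : unital_sc C u) (hC : commutative (mulc C))
  (hD : forall x y, mulc C x y = 0 -> x != 0 -> y = 0) : Type := scalg h.

Section ScField.
Variables (F : fieldType) (n : nat) (C : 'I_n -> 'M[F]_n) (u : 'rV[F]_n).
Variables (h : unital_sc C u) (hC : commutative (mulc C)).
Variable hD : forall x y, mulc C x y = 0 -> x != 0 -> y = 0.
Local Notation S := (scfield h hC hD).

HB.instance Definition _ := Falgebra.copy S (scalg h).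
HB.instance Definition _ := GRing.PzRing_hasCommutativeMul.Build S hC.

Fact scfield_axiom : GRing.field_axiom S.
Proof.
move=> x x0; have /falg_unit[y yx] : forall y : S, y * x = 0 -> y = 0.
  by move=> y yx; apply: (hD (x := x)) => //; rewrite hC.
by apply/unitrP; exists y; rewrite [x * y]mulrC yx.
Qed.

HB.instance Definition _ := GRing.ComUnitRing_isField.Build S scfield_axiom.

Definition scfield_coords : coords S C u := scalg_coords h.
Definition scfield_ext : fieldExtType F := S.

End ScField.

(** Replaces a statement quantified over all vectors by a matrix identity, which survives any
    specialization of the entries. *)
Lemma kernel_certificate (F : fieldType) (I : finType) m d
    (M : I -> 'M[F]_d) (B : 'M_(m, d)) :
  (forall x : 'rV_d, (forall i, x *m M i = 0) -> (x <= B)%MS) ->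
  exists (W : I -> 'M_d) (V : 'M_(d, m)), \sum_i M i *m W i + V *m B = 1%:M.
Proof.
move=> h; pose N := \mxrow_(i < #|I|) M (enum_val i).
(* With the generalized inverse of [N], the rows of [1 - N *m pinvmx N] are killed by [N], that is,
   by every [M i]; by hypothesis they lie in the row space of [B]. *)
have /submxP[V hV] : (1%:M - N *m pinvmx N <= B)%MS.
  apply/row_subP => l; apply: h => i.
  have : (1%:M - N *m pinvmx N) *m N = 0 by rewrite mulmxBl mul1mx mulmxKpV ?subrr.
  rewrite mul_mxrow => /(congr1 (@submxrow _ _ _ _ ^~ (enum_rank i))).
  rewrite mxrowK enum_rankK => H.
  by rewrite -row_mul H; apply/rowP => j; rewrite !mxE.
exists (fun i => submxcol (pinvmx N) (enum_rank i)), V.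
rewrite (reindex _ (onW_bij _ (enum_val_bij _))) /=.
under eq_bigr do rewrite enum_valK.
by rewrite -mul_mxrow_mxcol submxcolK -hV addrC subrK.
Qed.

(** * Maximal subfields as solutions of equations *)

(* The rows b_i of B are a basis of a subfield with structure constants c; B'
   certifies their independence.  W and V certify that the common kernel of the maps
   x |-> x b_i - b_i x lies in the row space of B, that is, maximality. *)
Definition maximal_embedding (F : fieldType) (d n : nat)
    (C : 'I_d -> 'M[F]_d) (u : 'rV[F]_d) (c : 'I_n -> 'M[F]_n) (w : 'rV[F]_n)
    (B : 'M[F]_(n, d)) (B' : 'M[F]_(d, n)) (W : 'I_n -> 'M[F]_d)
    (V : 'M[F]_(d, n)) : Prop :=
  [/\ forall i j, mulc C (row i B) (row j B) = row j (c i) *m B,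
      forall i j, row j (c i) = row i (c j),
      w *m B = u,
      B *m B' = 1%:M
    & \sum_i (rmulmx C (row i B) - lmulmx C (row i B)) *m W i + V *m B = 1%:M].

Section FromSubfield.
Variables (F : fieldType) (d n : nat) (C : 'I_d -> 'M[F]_d) (u : 'rV[F]_d).
Variables (c : 'I_n -> 'M[F]_n) (w : 'rV[F]_n).
Variables (A : unitAlgType F) (kA : coords A C u).
Variables (L : fieldExtType F) (kL : coords L c w) (f : {lrmorphism L -> A}).

(** [B] is the matrix of [f]. A vector that commutes with the rows of [B] commutes with their span
    [E], so it lies in [E] by maximality; [kernel_certificate] then produces [W] and [V]. *)
Lemma maximal_embedding_exists (E : A -> Prop) :
  maximal_subfield E -> (forall x, E x <-> exists y, x = f y) ->
  exists B B' W V, maximal_embedding C u c w B B' W V.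
Proof.
move=> [_ Emax] Ef; pose B := lin1_mx (to_rV kA \o f \o of_rV kL).
have BE v : v *m B = to_rV kA (f (of_rV kL v)) by rewrite mul_rV_lin1.
have rowB i : row i B = to_rV kA (f (of_rV kL (delta_mx 0 i))) by rewrite rowE BE.
have /row_freeP[B' BB'] : row_free B.
  apply: inj_row_free => v; rewrite BE => hv.
  apply: (can_inj (of_rVK kL)); apply: (fmorph_inj f).
  by apply: (can_inj (to_rVK kA)); rewrite hv linear0 rmorph0 linear0.
have [x xB|W [V WV]] :=
    @kernel_certificate F 'I_n n d (fun i => rmulmx C (row i B) - lmulmx C (row i B)) B.
  suff /Ef[y xy] : E (of_rV kA x).
    apply/submxP; exists (to_rV kL y); rewrite BE to_rVK -xy of_rVK //.
  apply/Emax => _ /Ef[y ->].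
  rewrite -[y](to_rVK kL) (row_sum_delta (to_rV kL y)) !linear_sum.
  apply: commr_sum => i _; rewrite !linearZ /=.
  rewrite /GRing.comm -scalerAl -scalerAr; congr (_ *: _).
  apply: (can_inj (to_rVK kA)); rewrite !to_rVM of_rVK -rowB.
  by apply/eqP; rewrite -subr_eq0 -mulc_rmulmx -mulmxBr xB.
exists B, B', W, V; split => // [i j|i j|].
- by rewrite !rowB -to_rVM -rmorphM -of_rVM mulc_delta BE.
- by rewrite -!mulc_delta; apply: (can_inj (of_rVK kL)); rewrite !of_rVM mulrC.
- by rewrite BE of_rV1 rmorph1 to_rV1.
Qed.

End FromSubfield.

Section ToSubfield.
Variables (F : fieldType) (d n : nat) (C : 'I_d -> 'M[F]_d) (u : 'rV[F]_d).
Variables (c : 'I_n -> 'M[F]_n) (w : 'rV[F]_n).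
Variables (A : unitAlgType F) (kA : coords A C u) (A_div : division_ring A).
Variables (B : 'M[F]_(n, d)) (B' : 'M[F]_(d, n)) (W : 'I_n -> 'M[F]_d).
Variables (V : 'M[F]_(d, n)) (hB : maximal_embedding C u c w B B' W V).

Let f v := of_rV kA (v *m B).

Let f_linear : linear f.
Proof. by move=> a x y; rewrite /f mulmxDl linearD -scalemxAl linearZ. Qed.
HB.instance Definition _ := GRing.isLinear.Build F 'rV[F]_n A _ f f_linear.

Let fM x y : f (mulc c x y) = f x * f y.
Proof.
have [hM _ _ _ _] := hB.
rewrite (row_sum_delta x) (row_sum_delta y) mulc_suml !linear_sum mulr_suml.
apply: eq_bigr => i _; rewrite mulc_sumr linear_sum mulr_sumr; apply: eq_bigr => j _.
rewrite mulcZl mulcZr !linearZ /= -scalerAl -scalerAr; congr (_ *: (_ *: _)).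
by rewrite mulc_delta /f -hM of_rVM !rowE.
Qed.

Let f1 : f w = 1.
Proof. by have [_ _ hw _ _] := hB; rewrite /f hw of_rV1. Qed.

Let f_inj : injective f.
Proof.
have [_ _ _ BB' _] := hB => x y /(can_inj (of_rVK kA)) /(congr1 (mulmx^~ B')).
by rewrite -!mulmxA BB' !mulmx1.
Qed.

Let cC : commutative (mulc c).
Proof.
have [_ hC _ _ _] := hB => x y.
rewrite (row_sum_delta x) (row_sum_delta y) mulc_suml mulc_sumr; apply: eq_bigr => i _.
rewrite mulc_suml mulc_sumr; apply: eq_bigr => j _.
by rewrite !mulcZl !mulcZr !mulc_delta scalerA mulrC -scalerA hC.
Qed.

(** Associativity and the unit laws are not part of [maximal_embedding]: they are pulled back from
    [A] along the injection [f]. The absence of zero divisors is obtained in the same way below. *)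
Let f_unital : unital_sc c w.
Proof.
split=> [x y z|x|x|]; try by apply: f_inj; rewrite !fM ?f1 ?mulrA ?mulr1 ?mul1r.
by apply/eqP => w0; have /eqP := f1; rewrite w0 linear0 eq_sym; apply/negP/oner_neq0.
Qed.

Let cD x y : mulc c x y = 0 -> x != 0 -> y = 0.
Proof.
move=> xy x0; have Ux : f x \is a GRing.unit.
  by apply: A_div; rewrite -(linear0 f) (inj_eq f_inj).
apply: f_inj; rewrite linear0; apply: (mulrI Ux).
by rewrite mulr0 -fM xy linear0.
Qed.

Lemma maximal_embedding_ext :
  exists L : fieldExtType F, inhabited (coords L c w).
Proof.
exists (scfield_ext f_unital cC cD); exact: (inhabits (scfield_coords _ _ _)).
Qed.

(** [L] is any field with these coordinates, because in the Galois case it has to be a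
    [splittingFieldType] constructed later on the same coordinates. *)
Lemma maximal_embedding_copy (L : fieldExtType F) (kL : coords L c w) :
  exists E : A -> Prop, maximal_subfield E /\ is_copy_of E L.
Proof.
pose g := f \o to_rV kL.
have gM : multiplicative g.
  by split=> [x y|]; rewrite /g /= ?to_rVM ?fM // to_rV1 f1.
pose gMM := GRing.isMultiplicative.Build L A g gM.
pose G : {lrmorphism L -> A} := HB.pack g gMM.
exists (fun x => exists y, x = G y); split; last by exists G.
split.
  split=> [|_ _ [x ->] [y ->]|_ _ [x ->] [y ->]|_ _ [x ->] [y ->]].
  - by exists 1; rewrite rmorph1.
  - by exists (x - y); rewrite rmorphB.
  - by exists (x / y); rewrite fmorph_div.
  - by rewrite /GRing.comm -!rmorphM mulrC.
move=> x; split=> [xG|[y ->] _ [z ->]]; last by rewrite /GRing.comm -!rmorphM mulrC.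
have [_ _ _ _ hV] := hB.
(* Multiplying the certificate on the left by the coordinates of [x] kills the commutator terms and
   leaves [x] as a combination of the rows of [B] with coefficients [x *m V]. *)
exists (of_rV kL (to_rV kA x *m V)); rewrite /= /g /= of_rVK /f -mulmxA.
rewrite -[LHS](to_rVK kA) -[to_rV kA x in LHS]mulmx1 -hV mulmxDr mulmx_sumr big1 ?add0r //.
move=> i _; rewrite mulmxA mulmxBr mulc_rmulmx.
have /xG : exists y, f (delta_mx 0 i) = G y.
  by exists (of_rV kL (delta_mx 0 i)); rewrite /= /g /= of_rVK.
rewrite /GRing.comm /f -rowE => /(congr1 (to_rV kA)); rewrite !to_rVM of_rVK => ->.
by rewrite subrr mul0mx.
Qed.

End ToSubfield.

(* Y certifies that the action M is faithful, W and V that the fixed field is the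
   line of w. *)
Definition galois_action (F : fieldType) (n : nat) (c : 'I_n -> 'M[F]_n)
    (w : 'rV[F]_n) (gT : finGroupType) (M Y W : gT -> 'M[F]_n) (V : 'M[F]_(n, 1)) :=
  [/\ forall g i j, row j (c i) *m M g = mulc c (row i (M g)) (row j (M g)),
      forall g, w *m M g = w,
      M 1%g = 1%:M /\ forall g h, M (g * h)%g = M g *m M h,
      forall g, g != 1%g -> \tr ((M g - 1%:M) *m Y g) = 1
    & \sum_g (M g - 1%:M) *m W g + V *m w = 1%:M].

(** Nondegeneracy of the trace form turns [M != 0] into an equation. *)
Lemma mxtrace_certificate (F : fieldType) n (M : 'M[F]_n) :
  M != 0 -> exists Y, \tr (M *m Y) = 1.
Proof.
move=> /matrix0Pn[i [j Mij]]; exists ((M i j)^-1 *: delta_mx j i).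
rewrite -scalemxAr linearZ /= /mxtrace (bigD1 i) //= big1 => [|l li].
  rewrite addr0 !mxE (bigD1 j) //= big1 => [|l lj].
    by rewrite !mxE !eqxx mulr1 addr0 mulVf.
  by rewrite !mxE (negbTE lj) mulr0.
by rewrite !mxE big1 // => k _; rewrite !mxE (negbTE li) andbF mulr0.
Qed.

(** [M g] is the matrix of the automorphism attached to [g]. Row vectors are acted on from the
    right, which agrees with the order of composition in Galois groups, so [M] is multiplicative
    without passing to inverses. *)
Lemma galois_action_exists (F : fieldType) (n : nat) (c : 'I_n -> 'M[F]_n)
    (w : 'rV[F]_n) (L : splittingFieldType F) (kL : coords L c w)
    (gT : finGroupType) :
  galois 1%VS {:L}%VS -> [set: gT] \isog 'Gal({:L} / 1) ->
  exists M Y W V, @galois_action F n c w gT M Y W V.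
Proof.
move=> /galois_fixedField fixL /isogP[s s_inj s_im].
pose M g := lin1_mx (to_rV kL \o s g \o of_rV kL).
have ME g v : v *m M g = to_rV kL (s g (of_rV kL v)) by rewrite mul_rV_lin1.
have MrV g x : to_rV kL x *m M g = to_rV kL (s g x) by rewrite ME to_rVK.
have /fin_all_exists[Y hY] g : exists Y, g != 1%g -> \tr ((M g - 1%:M) *m Y) = 1.
  (* Nothing is required at the neutral element, where 0 is a default value. *)
  have [->|g1] := eqVneq g 1%g; first by exists 0.
  have /mxtrace_certificate[Y hY] : M g - 1%:M != 0; last by exists Y.
  apply: contraNneq g1 => /eqP; rewrite subr_eq0 => /eqP Mg1.
  apply/eqP/(injmP s_inj); rewrite ?inE // morph1; apply/eqP/gal_eqP => x _.
  by rewrite gal_id; apply: (can_inj (to_rVK kL)); rewrite -MrV Mg1 mulmx1.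
have [x hx|W [V WV]] := @kernel_certificate F gT 1 n (fun g => M g - 1%:M) w.
  have : of_rV kL x \in 1%VS.
    rewrite -fixL; apply/fixedFieldP; first exact: memvf.
    move=> h hG; have /morphimP[g _ _ ->] : h \in (s @* [set: gT])%g by rewrite s_im.
    apply: (can_inj (to_rVK kL)); rewrite -MrV of_rVK; apply/eqP.
    by rewrite -subr_eq0 -[X in _ - X]mulmx1 -mulmxBr hx.
  case/vlineP => a xa; rewrite -(of_rVK kL x) xa linearZ /= to_rV1.
  exact: scalemx_sub.
exists M, Y, W, V; split=> // [g i j|g|].
- by rewrite -mulc_delta (rowE i) (rowE j) !ME -to_rVM -rmorphM -of_rVM.
- by rewrite ME of_rV1 rmorph1 to_rV1.
- split=> [|g h].
    by apply/row_matrixP => i; rewrite !rowE ME morph1 gal_id of_rVK mulmx1.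
  apply/row_matrixP => i; rewrite !rowE mulmxA !ME to_rVK morphM ?inE //.
  by rewrite galM ?memvf.
Qed.

Section GaloisOfAction.
Variables (F : fieldType) (n : nat) (c : 'I_n -> 'M[F]_n) (w : 'rV[F]_n).
Variables (L : fieldExtType F) (kL : coords L c w).
Variables (gT : finGroupType) (M Y W : gT -> 'M[F]_n) (V : 'M[F]_(n, 1)).
Hypothesis hM : galois_action c w M Y W V.

Definition act_hom g x := of_rV kL (to_rV kL x *m M g).

Let act_linear g : linear (act_hom g).
Proof. by move=> a x y; rewrite /act_hom linearP mulmxDl -scalemxAl linearP. Qed.
HB.instance Definition _ g :=
  GRing.isLinear.Build F L L _ (act_hom g) (act_linear g).

Let act_multiplicative g : multiplicative (act_hom g).
Proof.
have [hm h1 _ _ _] := hM; split=> [x y|]; last first.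
  by rewrite /act_hom to_rV1 h1 of_rV1.
rewrite /act_hom to_rVM -of_rVM; congr (of_rV kL _).
rewrite (row_sum_delta (to_rV kL x)) (row_sum_delta (to_rV kL y)).
rewrite mulc_suml !mulmx_suml mulc_suml; apply: eq_bigr => i _.
rewrite !mulc_sumr mulmx_suml; apply: eq_bigr => j _.
by rewrite -!scalemxAl !mulcZl !mulcZr -!scalemxAl mulc_delta hm !rowE.
Qed.
HB.instance Definition _ g :=
  GRing.isMultiplicative.Build L L (act_hom g) (act_multiplicative g).

Let act1 x : act_hom 1%g x = x.
Proof. by have [_ _ [h1 _] _ _] := hM; rewrite /act_hom h1 mulmx1 to_rVK. Qed.

Let actM g h x : act_hom (g * h)%g x = act_hom h (act_hom g x).
Proof.
by have [_ _ [_ h2] _ _] := hM; rewrite /act_hom h2 of_rVK mulmxA.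
Qed.

Let act_faithful g : act_hom g =1 id -> g = 1%g.
Proof.
have [_ _ _ hY _] := hM => hg; apply/eqP; apply: contraT => /hY.
suff -> : M g = 1%:M by rewrite subrr mul0mx mxtrace0 => /esym/eqP; rewrite (negbTE (oner_neq0 _)).
apply/row_matrixP => i; rewrite !rowE mulmx1; apply: (can_inj (of_rVK kL)).
by have := hg (of_rV kL (delta_mx 0 i)); rewrite /act_hom of_rVK.
Qed.

Let act_fixed x : (forall g, act_hom g x = x) -> x \in 1%VS.
Proof.
have [_ _ _ _ hV] := hM => hx.
apply/vlineP; exists ((to_rV kL x *m V) 0 0).
rewrite -[LHS](to_rVK kL) -[to_rV kL x in LHS]mulmx1 -hV mulmxDr mulmx_sumr.
rewrite big1 ?add0r => [|g _].
  by rewrite mulmxA {1}[to_rV kL x *m V]mx11_scalar mul_scalar_mx linearZ /= of_rV1.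
rewrite mulmxA mulmxBr mulmx1 -[to_rV kL x *m M g](of_rVK kL).
by rewrite -[of_rV _ _]/(act_hom g x) hx subrr mul0mx.
Qed.

Let root (q : 'I_n * gT) : L := act_hom q.2 (of_rV kL (delta_mx 0 q.1)).

(** [L] is generated by the roots of the product of all ['X - g b], for [b] a basis vector and [g]
    in the group. Its coefficients are invariant under the action, so they lie in the base field. *)
Let splitting : SplittingField.axiom L.
Proof.
pose p := \prod_q ('X - (root q)%:P); exists p.
  apply/polyOverP => i; apply: act_fixed => h.
  suff pE : map_poly (act_hom h) p = p by rewrite -[in RHS]pE coef_map.
  rewrite /p rmorph_prod /=.
  (* Applying [h] to the roots permutes them by right translation of the group index. *)
  pose t (q : 'I_n * gT) := (q.1, q.2 * h)%g.
  have t_bij : bijective t.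
    by exists (fun q => (q.1, q.2 * h^-1)%g) => -[a b]; rewrite /t /= ?mulgK ?mulgKV.
  rewrite [RHS](reindex t) /=; last exact: onW_bij.
  by apply: eq_bigr => q _; rewrite map_polyXsubC /root /= actM.
exists [seq root q | q <- index_enum _].
  by rewrite big_map eqpxx.
apply/vspaceP => x; rewrite memvf -[x](to_rVK kL) (row_sum_delta (to_rV kL x)).
rewrite linear_sum rpred_sum // => i _; rewrite linearZ rpredZ //.
apply: seqv_sub_adjoin; apply/mapP; exists (i, 1%g); first by rewrite mem_index_enum.
by rewrite /root act1.
Qed.

(** Artin's theorem: an extension is Galois over the fixed field of a finite group of automorphisms,
    with that group as Galois group. Here the fixed field is the base field, and faithfulness
    identifies the group with [gT]. *)
Lemma galois_of_action : exists L' : splittingFieldType F,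
  [/\ inhabited (coords L' c w), galois 1%VS {:L'}%VS
    & 'Gal({:L'} / 1) \isog [set: gT]].
Proof.
pose L' : splittingFieldType F :=
  HB.pack (FieldExt.sort L) (FieldExt_isSplittingField.Build F L splitting).
pose e g : 'End(L') := linfun (act_hom g : L' -> L').
have eE g x : e g x = act_hom g x by rewrite lfunE.
have kAut_e g : kAut 1 {:L'} (e g).
  rewrite /kAut; apply/andP; split.
    apply/kHomP_tmp; split=> [x /vlineP[a ->]|x y _ _].
      by rewrite eE linearZ rmorph1.
    by rewrite !eE rmorphM.
  apply/eqP/vspaceP => x; rewrite memvf; apply/memv_imgP.
  by exists (act_hom g^-1%g x); rewrite ?memvf // eE -actM mulVg act1.
pose s g : gal_of {:L'} := s2val (kAut_to_gal (kAut_e g)).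
have sE g x : s g x = act_hom g x.
  by rewrite -eE /s; case: kAut_to_gal => h /= _ ->; rewrite ?memvf.
have sM : {in [set: gT] &, {morph s : g h / (g * h)%g}}.
  move=> g h _ _; apply/eqP/gal_eqP => x _.
  by rewrite galM ?memvf // !sE actM.
pose S := Morphism sM.
have fixS : fixedField (S @* [set: gT])%g = 1%VS.
  apply/eqP; rewrite eqEsubv sub1v andbT; apply/subvP => x.
  move=> /mem_fixedFieldP[_ hx]; apply: act_fixed => g.
  by rewrite -sE; apply: hx; rewrite (mem_morphim S).
have GalS : ('Gal({:L'} / 1) = S @* [set: gT])%g by rewrite -fixS gal_fixedField.
exists L'; split; first exact: (inhabits kL).
  by rewrite -fixS fixedField_galois.
rewrite GalS isog_sym sub_isog //; apply/injmP => g h _ _ /= sgh.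
apply/eqP; rewrite eq_mulVg1; apply/eqP/act_faithful => x.
by rewrite actM -sE -sgh sE -actM mulVg act1.
Qed.

End GaloisOfAction.

(* z certifies that the exponent is not smaller than r: it vanishes on the line of w
   but not at some power of exponent p ^ r.-1. *)
Definition insep_data (F : fieldType) (n : nat) (c : 'I_n -> 'M[F]_n)
    (w : 'rV[F]_n) (p r : nat) (t : 'I_n -> F) (z : 'cV[F]_n) :=
  (forall i, powc c w (delta_mx 0 i) (p ^ r) = t i *: w) /\
  ((0 < r)%N ->
     exists i, w *m z = 0 /\ powc c w (delta_mx 0 i) (p ^ r.-1) *m z = 1%:M).

Section Insep.
Variables (F : fieldType) (n : nat) (c : 'I_n -> 'M[F]_n) (w : 'rV[F]_n).
Variables (L : fieldExtType F) (kL : coords L c w).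
Variables (p : nat) (p_char : p \in [pchar F]).

Let charL : p \in [pchar L]. Proof. by rewrite pchar_lalg. Qed.

Let pnat_char s : [pchar L].-nat (p ^ s)%N.
Proof.
rewrite (eq_pnat _ (pcharf_eq charL)) pnatX.
by rewrite pnat_id ?(pcharf_prime charL).
Qed.

(** In characteristic [p] the power map of exponent [p ^ s] is additive, so it suffices to look at a
    basis. *)
Lemma insep_power_basis s :
  (forall i, of_rV kL (delta_mx 0 i) ^+ (p ^ s) \in 1%VS) ->
  forall x : L, x ^+ (p ^ s) \in 1%VS.
Proof.
move=> h x; rewrite -[x](to_rVK kL) (row_sum_delta (to_rV kL x)) linear_sum.
elim/big_rec: _ => [|i y _ IH]; first by rewrite expr0n; case: eqP; rewrite ?mem1v ?mem0v.
by rewrite exprDn_pchar ?pnat_char // rpredD // linearZ exprZn rpredZ.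
Qed.

Lemma insep_data_exists r :
  insep_exponent p r L -> exists t z, insep_data c w p r t z.
Proof.
case=> hr r_min.
have /fin_all_exists[t ht] i : exists a, powc c w (delta_mx 0 i) (p ^ r) = a *: w.
  have /vlineP[a ha] := hr (of_rV kL (delta_mx 0 i)).
  exists a; apply: (can_inj (of_rVK kL)).
  by rewrite of_rV_pow ha linearZ /= of_rV1.
(* For [r = 0] minimality is automatic and there is no linear form to find. *)
case: r hr r_min ht => [|r] hr r_min ht; first by exists t, 0; split.
(* By minimality of the exponent, now [r.+1], some basis vector has its power of exponent [p ^ r]
   outside the base field. *)
have /existsP[i hi] :
    [exists i, of_rV kL (delta_mx 0 i) ^+ (p ^ r) \notin 1%VS].
  apply: contraT => /existsPn h.
  suff /r_min : forall x : L, x ^+ (p ^ r) \in 1%VS by rewrite ltnn.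
  by apply: insep_power_basis => i; apply/negbNE/h.
set v := powc c w (delta_mx 0 i) (p ^ r).
have : ~~ (v <= w)%MS.
  apply: contra hi => /sub_rVP[a va]; apply/vlineP; exists a.
  by rewrite -of_rV_pow -/v va linearZ /= of_rV1.
(* The columns of the cokernel matrix of [w] are linear forms vanishing on the line of [w]. One of
   them does not vanish at [v], and it is rescaled to take the value 1 there. *)
rewrite submxE; move: (cokermx w) (mulmx_coker w) => K wK.
move=> /matrix0Pn[o [j]]; rewrite ord1 => hj.
exists t, (((v *m K) 0 j)^-1 *: col j K); split=> // _.
exists i; rewrite /= -/v -!scalemxAr colE !mulmxA wK; split.
  by rewrite mul0mx scaler0.
have -> : v *m K *m delta_mx j 0 = ((v *m K) 0 j)%:M.
  by rewrite -colE [LHS]mx11_scalar [in LHS]mxE.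
by rewrite -scalemx1 scalerA mulVf // scale1r.
Qed.

Lemma insep_of_data r t z : insep_data c w p r t z ->
  purely_inseparable 1%VS {:L}%VS /\ insep_exponent p r L.
Proof.
case=> ht hz; have hr : forall x : L, x ^+ (p ^ r) \in 1%VS.
  apply: insep_power_basis => i; rewrite -of_rV_pow ht linearZ /= of_rV1.
  by rewrite rpredZ ?mem1v.
split; last split=> // s hs.
  apply/purely_inseparableP => y _; apply/purely_inseparable_elementP_pchar.
  by exists (p ^ r)%N.
case: r ht hz hr => // r ht hz hr; rewrite ltnNge; apply/negP => sr.
have [i [wz]] := hz isT; rewrite /= => /esym/eqP.
suff /vlineP[a ha] : of_rV kL (delta_mx 0 i) ^+ (p ^ r) \in 1%VS.
  have -> : powc c w (delta_mx 0 i) (p ^ r) = a *: w.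
    apply: (can_inj (of_rVK kL)).
    by rewrite of_rV_pow ha linearZ /= of_rV1.
  by rewrite -scalemxAl wz scaler0 (negbTE (oner_neq0 _)).
by rewrite -(subnK sr) addnC expnD exprM rpredX.
Qed.

End Insep.

(** * Specialization of solutions *)

(* r is the graph of a ring homomorphism from a subring of F1 containing Z to F2. *)
Record specialization (Z F1 F2 : fieldType) (k1 : Z -> F1) (k2 : Z -> F2)
    (r : F1 -> F2 -> Prop) : Prop := Specialization {
  spec_const : forall z, r (k1 z) (k2 z);
  specD : forall a a' b b', r a a' -> r b b' -> r (a + b) (a' + b');
  specN : forall a a', r a a' -> r (- a) (- a');
  specM : forall a a' b b', r a a' -> r b b' -> r (a * b) (a' * b');
  spec_fun : forall a b b', r a b -> r a b' -> b = b' }.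

(** The graph may depend on the finite list: a point of evaluation has to be chosen after the
    denominators are known. *)
Definition specializes (Z F1 F2 : fieldType) (k1 : Z -> F1) (k2 : Z -> F2) :=
  forall s : seq F1, exists2 r, specialization k1 k2 r
    & forall a, a \in s -> exists b, r a b.

Section SpecMx.
Variables (Z F1 F2 : fieldType) (k1 : {rmorphism Z -> F1}) (k2 : {rmorphism Z -> F2}).
Variables (r : F1 -> F2 -> Prop) (hr : specialization k1 k2 r).

Definition mxspec m n (A : 'M[F1]_(m, n)) (A' : 'M[F2]_(m, n)) :=
  forall i j, r (A i j) (A' i j).

Lemma spec0 : r 0 0.
Proof. by have := spec_const hr 0; rewrite !rmorph0. Qed.

Lemma spec1 : r 1 1.
Proof. by have := spec_const hr 1; rewrite !rmorph1. Qed.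

Lemma spec_sum (I : Type) (s : seq I) (P : pred I) f f' :
  (forall i, r (f i) (f' i)) -> r (\sum_(i <- s | P i) f i) (\sum_(i <- s | P i) f' i).
Proof.
by move=> h; elim/big_rec2: _ => [|i y x _]; [exact: spec0 | exact: (specD hr)].
Qed.

(** The transfer principle: both sides of an equation are related to their specializations, and
    these agree since the graph is functional. *)
Lemma mxspec_eq m n (A B : 'M_(m, n)) (A' B' : 'M_(m, n)) :
  mxspec A A' -> mxspec B B' -> A = B -> A' = B'.
Proof.
move=> hA hB AB; apply/matrixP => i j; apply: (spec_fun hr (hA i j)).
by rewrite AB.
Qed.

Lemma mxspecM m n q (A : 'M_(m, n)) (B : 'M_(n, q)) A' B' :
  mxspec A A' -> mxspec B B' -> mxspec (A *m B) (A' *m B').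
Proof. by move=> hA hB i j; rewrite !mxE; apply: spec_sum => l; apply: (specM hr). Qed.

Lemma mxspecD m n (A B : 'M_(m, n)) A' B' :
  mxspec A A' -> mxspec B B' -> mxspec (A + B) (A' + B').
Proof. by move=> hA hB i j; rewrite !mxE; apply: (specD hr). Qed.

Lemma mxspecB m n (A B : 'M_(m, n)) A' B' :
  mxspec A A' -> mxspec B B' -> mxspec (A - B) (A' - B').
Proof. by move=> hA hB i j; rewrite !mxE; apply: (specD hr) => //; apply: (specN hr). Qed.

Lemma mxspecZ m n a a' (A : 'M_(m, n)) A' :
  r a a' -> mxspec A A' -> mxspec (a *: A) (a' *: A').
Proof. by move=> ha hA i j; rewrite !mxE; apply: (specM hr). Qed.

Lemma mxspec_row m n (A : 'M_(m, n)) A' i :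
  mxspec A A' -> mxspec (row i A) (row i A').
Proof. by move=> hA k j; rewrite !mxE. Qed.

Lemma mxspec_sum (I : Type) (s : seq I) (P : pred I) m n (f : I -> 'M_(m, n)) f' :
  (forall i, mxspec (f i) (f' i)) ->
  mxspec (\sum_(i <- s | P i) f i) (\sum_(i <- s | P i) f' i).
Proof. by move=> h i j; rewrite !summxE; apply: spec_sum => l; apply: h. Qed.

Lemma mxspec_map m n (A : 'M[Z]_(m, n)) : mxspec (map_mx k1 A) (map_mx k2 A).
Proof. by move=> i j; rewrite !mxE; apply: spec_const. Qed.

Lemma mxspec1 n : mxspec (1%:M : 'M_n) 1%:M.
Proof. by have := @mxspec_map n n 1%:M; rewrite !map_mx1. Qed.

Lemma mxspec0 m n : mxspec (0 : 'M_(m, n)) 0.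
Proof. by have := @mxspec_map m n 0; rewrite !map_mx0. Qed.

Lemma mxspec_delta m n i j : mxspec (delta_mx i j : 'M_(m, n)) (delta_mx i j).
Proof. by have := mxspec_map (delta_mx i j); rewrite !map_delta_mx. Qed.

Lemma spec_trace n (A : 'M_n) A' : mxspec A A' -> r (\tr A) (\tr A').
Proof. by move=> hA; apply: spec_sum => i; apply: hA. Qed.

Section Sc.
Variables (n : nat) (c : 'I_n -> 'M[F1]_n) (c' : 'I_n -> 'M[F2]_n).
Hypothesis hc : forall i, mxspec (c i) (c' i).

Lemma mxspec_lmulmx x x' : mxspec x x' -> mxspec (lmulmx c x) (lmulmx c' x').
Proof. by move=> hx; apply: mxspec_sum => i; apply: mxspecZ. Qed.

Lemma mxspec_mulc x x' y y' :
  mxspec x x' -> mxspec y y' -> mxspec (mulc c x y) (mulc c' x' y').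
Proof. by move=> hx hy; apply: mxspecM => //; apply: mxspec_lmulmx. Qed.

Lemma mxspec_rmulmx y y' : mxspec y y' -> mxspec (rmulmx c y) (rmulmx c' y').
Proof.
by move=> hy i j; rewrite ![rmulmx _ _ _ _]mxE; apply: mxspecM.
Qed.

Lemma mxspec_powc u u' x x' m :
  mxspec u u' -> mxspec x x' -> mxspec (powc c u x m) (powc c' u' x' m).
Proof. by move=> hu hx; elim: m => //= m; apply: mxspec_mulc. Qed.

End Sc.

(** Collects coefficients in one list, so that a single specialization can be required to be defined
    at all unknowns at once. *)
Definition entries (I : finType) m n (M : I -> 'M[F1]_(m, n)) : seq F1 :=
  [seq M q.1 q.2.1 q.2.2 | q : I * ('I_m * 'I_n)].

Variable s : seq F1.
Hypothesis hs : forall a, a \in s -> exists b, r a b.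

Lemma mxspec_exists (I : finType) m n (M : I -> 'M[F1]_(m, n)) :
  {subset entries M <= s} -> exists M', forall i, mxspec (M i) (M' i).
Proof.
move=> h; have /fin_all_exists[f hf] q : exists b, r (M q.1 q.2.1 q.2.2) b.
  by apply/hs/h/mapP; exists q; rewrite ?mem_enum.
exists (fun i => \matrix_(k, l) f (i, (k, l))) => i k l.
by rewrite mxE; apply: (hf (i, (k, l))).
Qed.

Lemma mxspec_exists1 m n (M : 'M[F1]_(m, n)) :
  {subset entries (fun _ : unit => M) <= s} -> exists M', mxspec M M'.
Proof. by case/mxspec_exists => M' /(_ tt); exists (M' tt). Qed.

End SpecMx.

#[local] Hint Resolve mxspecM mxspecD mxspecB mxspecZ mxspec_row mxspec_sum
  mxspec1 mxspec0 mxspec_delta mxspec_lmulmx mxspec_mulc mxspec_rmulmx mxspec_powc : spec.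
#[local] Hint Extern 0 (mxspec _ (row _ _) _) => apply: mxspec_row : spec.

Section SpecData.
Variables (Z F1 F2 : fieldType) (k1 : {rmorphism Z -> F1}) (k2 : {rmorphism Z -> F2}).
Variables (r : F1 -> F2 -> Prop) (hr : specialization k1 k2 r).
Variables (n : nat) (c : 'I_n -> 'M[F1]_n) (c' : 'I_n -> 'M[F2]_n).
Hypothesis hc : forall i, mxspec r (c i) (c' i).
Variables (w : 'rV[F1]_n) (w' : 'rV[F2]_n).
Hypothesis hw : mxspec r w w'.

Lemma maximal_embedding_spec d (C : 'I_d -> 'M[Z]_d) (u : 'rV[Z]_d)
    B1 B1' W1 V1 B2 B2' W2 V2 :
  mxspec r B1 B2 -> mxspec r B1' B2' -> (forall i, mxspec r (W1 i) (W2 i)) ->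
  mxspec r V1 V2 ->
  maximal_embedding (fun i => map_mx k1 (C i)) (map_mx k1 u) c w B1 B1' W1 V1 ->
  maximal_embedding (fun i => map_mx k2 (C i)) (map_mx k2 u) c' w' B2 B2' W2 V2.
Proof.
move=> hB hB' hW hV [e1 e2 e3 e4 e5].
have hC i : mxspec r (map_mx k1 (C i)) (map_mx k2 (C i)) by apply: mxspec_map.
have hu : mxspec r (map_mx k1 u) (map_mx k2 u) by apply: mxspec_map.
split=> [i j|i j|||].
- by apply: (mxspec_eq hr _ _ (e1 i j)); eauto with spec.
- by apply: (mxspec_eq hr _ _ (e2 i j)); eauto with spec.
- by apply: (mxspec_eq hr _ _ e3); eauto with spec.
- by apply: (mxspec_eq hr _ _ e4); eauto with spec.
- apply: (mxspec_eq hr _ _ e5); last exact: (mxspec1 hr).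
  apply: (mxspecD hr); last exact: (mxspecM hr).
  apply: (mxspec_sum hr) => i; apply: (mxspecM hr) => //.
  by apply: (mxspecB hr); [apply: mxspec_rmulmx | apply: mxspec_lmulmx]; eauto with spec.
Qed.

Lemma galois_action_spec (gT : finGroupType) M1 Y1 W1 V1 M2 Y2 W2 V2 :
  (forall g, mxspec r (M1 g) (M2 g)) -> (forall g, mxspec r (Y1 g) (Y2 g)) ->
  (forall g, mxspec r (W1 g) (W2 g)) -> mxspec r V1 V2 ->
  @galois_action F1 n c w gT M1 Y1 W1 V1 -> galois_action c' w' M2 Y2 W2 V2.
Proof.
move=> hM hY hW hV [e1 e2 [e3 e4] e5 e6].
split=> [g i j|g||g g1|].
- by apply: (mxspec_eq hr _ _ (e1 g i j)); eauto with spec.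
- by apply: (mxspec_eq hr _ _ (e2 g)); eauto with spec.
- split=> [|g h]; first by apply: (mxspec_eq hr _ _ e3); eauto with spec.
  by apply: (mxspec_eq hr _ _ (e4 g h)); eauto with spec.
- apply: (spec_fun hr _ (spec1 hr)); rewrite -(e5 g g1).
  by apply: (spec_trace hr); eauto with spec.
- apply: (mxspec_eq hr _ _ e6); last exact: (mxspec1 hr).
  apply: (mxspecD hr); last exact: (mxspecM hr).
  by apply: (mxspec_sum hr) => g; eauto with spec.
Qed.

Lemma insep_data_spec p s (t : 'I_n -> F1) (z : 'cV_n) t' z' :
  (forall i, r (t i) (t' i)) -> mxspec r z z' ->
  insep_data c w p s t z -> insep_data c' w' p s t' z'.
Proof.
move=> ht hz [e1 e2]; split=> [i|/e2[i [e3 e4]]].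
  by apply: (mxspec_eq hr _ _ (e1 i)); eauto with spec.
exists i; split; first by apply: (mxspec_eq hr _ _ e3); eauto with spec.
by apply: (mxspec_eq hr _ _ e4); eauto with spec.
Qed.

End SpecData.

(** * Transfer of maximal subfields from one ground field to another *)

Definition galois_group_subfield (gT : finGroupType) (F : fieldType)
    (A : unitAlgType F) (E : A -> Prop) : Prop :=
  exists L : splittingFieldType F,
    [/\ is_copy_of E L, galois 1%VS {:L}%VS
      & 'Gal({:L} / 1) \isog [set: gT]].

(** Reduces the Galois property to the case of a prescribed group, which is what an action by
    matrices can express. *)
Lemma galois_subfieldP (F : fieldType) (A : unitAlgType F) :
  has_maximal_subfield (@galois_subfield F A) <->
  exists gT : finGroupType, has_maximal_subfield (@galois_group_subfield gT F A).
Proof.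
split=> [[E [Emax [L [EL galL]]]]|[gT [E [Emax [L [EL galL _]]]]]].
  exists (subg_of 'Gal({:L} / 1)), E; split=> //; exists L; split=> //.
  exact: isog_subg.
by exists E; split=> //; exists L.
Qed.

Section Transfer.
Variables (Z F1 F2 : fieldType) (k1 : {rmorphism Z -> F1}) (k2 : {rmorphism Z -> F2}).
Hypothesis hk : specializes k1 k2.
Variables (d : nat) (C : 'I_d -> 'M[Z]_d) (u : 'rV[Z]_d).
Variables (A1 : unitAlgType F1) (A2 : unitAlgType F2).
Variables (K1 : coords A1 (fun i => map_mx k1 (C i)) (map_mx k1 u)).
Variables (K2 : coords A2 (fun i => map_mx k2 (C i)) (map_mx k2 u)).
Hypothesis A2_div : division_ring A2.

(** The list [s] holds further data on [L], such as a group action. The relation [r] and the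
    constants [c] and [w] are returned so that these data are specialized compatibly with the
    embedding. *)
Lemma maximal_embedding_transfer (E : A1 -> Prop) (L : fieldExtType F1) (s : seq F1) :
  maximal_subfield E -> is_copy_of E L -> exists r c w,
  [/\ specialization k1 k2 r, forall a, a \in s -> exists b, r a b,
      forall i, mxspec r (@falg_sc F1 L i) (c i), mxspec r (v2r (1 : L)) w
    & (exists L' : fieldExtType F2, inhabited (coords L' c w)) /\
      forall L' : fieldExtType F2, coords L' c w ->
        exists E' : A2 -> Prop, maximal_subfield E' /\ is_copy_of E' L'].
Proof.
move=> Emax [f Ef].
have [B [B' [W [V hB]]]] := maximal_embedding_exists K1 (falg_coords L) Emax Ef.
have [r hr] := hk (entries (@falg_sc F1 L) ++ entries (fun _ : unit => v2r (1 : L))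
  ++ entries (fun _ : unit => B) ++ entries (fun _ : unit => B') ++ entries W
  ++ entries (fun _ : unit => V) ++ s).
set S := _ ++ _ => hs.
have [|c hc] := mxspec_exists hs (M := @falg_sc F1 L).
  by move=> a; rewrite !mem_cat => ->.
have [|w hw] := mxspec_exists1 hs (M := v2r (1 : L)).
  by move=> a; rewrite !mem_cat => ->; rewrite ?orbT.
have [|B2 hB2] := mxspec_exists1 hs (M := B).
  by move=> a; rewrite !mem_cat => ->; rewrite ?orbT.
have [|B2' hB2'] := mxspec_exists1 hs (M := B').
  by move=> a; rewrite !mem_cat => ->; rewrite ?orbT.
have [|W2 hW2] := mxspec_exists hs (M := W).
  by move=> a; rewrite !mem_cat => ->; rewrite ?orbT.
have [|V2 hV2] := mxspec_exists1 hs (M := V).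
  by move=> a; rewrite !mem_cat => ->; rewrite ?orbT.
have hB2all := maximal_embedding_spec hr hc hw hB2 hB2' hW2 hV2 hB.
exists r, c, w; split=> //.
  by move=> a sa; apply: hs; rewrite !mem_cat sa !orbT.
split; first exact: (maximal_embedding_ext K2 A2_div hB2all).
by move=> L' kL'; apply: (maximal_embedding_copy K2 hB2all kL').
Qed.

Lemma galois_group_transfer gT :
  has_maximal_subfield (@galois_group_subfield gT F1 A1) ->
  has_maximal_subfield (@galois_group_subfield gT F2 A2).
Proof.
move=> [E [Emax [L [EL galL isoL]]]].
have [|M [Y [W [V hM]]]] := galois_action_exists (falg_coords L) galL (gT := gT).
  by rewrite isog_sym.
have [r [c [w [hr hs hc hw [[L' [kL']] hE]]]]] := maximal_embedding_transfer
  (entries M ++ entries Y ++ entries W ++ entries (fun _ : unit => V)) Emax EL.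
have [|M2 hM2] := mxspec_exists hs (M := M).
  by move=> a; rewrite !mem_cat => ->.
have [|Y2 hY2] := mxspec_exists hs (M := Y).
  by move=> a; rewrite !mem_cat => ->; rewrite ?orbT.
have [|W2 hW2] := mxspec_exists hs (M := W).
  by move=> a; rewrite !mem_cat => ->; rewrite ?orbT.
have [|V2 hV2] := mxspec_exists1 hs (M := V).
  by move=> a; rewrite !mem_cat => ->; rewrite ?orbT.
have hMall := galois_action_spec hr hc hw hM2 hY2 hW2 hV2 hM.
have [L2 [[kL2] galL2 isoL2]] := galois_of_action kL' hMall.
have [E' [E'max E'L]] := hE L2 kL2.
by exists E'; split=> //; exists L2.
Qed.

Lemma purely_insep_transfer p s : p \in [pchar Z] ->
  has_maximal_subfield (@purely_insep_subfield p s F1 A1) ->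
  has_maximal_subfield (@purely_insep_subfield p s F2 A2).
Proof.
move=> p_charZ [E [Emax [L [EL _ insepL]]]].
have p_char1 : p \in [pchar F1].
  by rewrite (fmorph_pchar k1).
have p_char : p \in [pchar F2] by rewrite (fmorph_pchar k2).
have [t [z htz]] := insep_data_exists (falg_coords L) p_char1 insepL.
have [r [c [w [hr hs hc hw [[L' [kL']] hE]]]]] := maximal_embedding_transfer
  (codom t ++ entries (fun _ : unit => z)) Emax EL.
have /fin_all_exists[t2 ht2] i : exists b, r (t i) b.
  by apply: hs; rewrite mem_cat codom_f.
have [|z2 hz2] := mxspec_exists1 hs (M := z).
  by move=> a; rewrite !mem_cat => ->; rewrite ?orbT.
have [pinsep exp] := insep_of_data kL' p_char (insep_data_spec hr hc hw ht2 hz2 htz).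
have [E' [E'max E'L]] := hE L' kL'.
by exists E'; split=> //; exists L'.
Qed.

End Transfer.

(** * Tensor powers *)

Section TensorSc.
Variables (R : comNzRingType) (m n : nat).

(** The tensor product of the row spaces is the space of [m] by [n] matrices, flattened; pure
    tensors are the products of a column and a row. *)
Definition tensr (x : 'rV[R]_m) (y : 'rV[R]_n) : 'rV[R]_(m * n) :=
  mxvec (x^T *m y).

Fact tensr_bilinear : bilinear_for *:%R *:%R tensr.
Proof.
split=> [y a x x'|x a y y'] /=; rewrite /tensr.
  by rewrite linearP mulmxDl -scalemxAl linearP.
by rewrite mulmxDr -scalemxAr linearP.
Qed.
HB.instance Definition _ :=
  bilinear_isBilinear.Build R 'rV[R]_m 'rV[R]_n 'rV[R]_(m * n) _ _ tensr tensr_bilinear.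

Lemma tensr_sum (v : 'rV_(m * n)) :
  v = \sum_i \sum_j vec_mx v i j *: tensr (delta_mx 0 i) (delta_mx 0 j).
Proof.
rewrite -[LHS]vec_mxK [X in mxvec X]matrix_sum_delta linear_sum.
apply: eq_bigr => i _; rewrite linear_sum; apply: eq_bigr => j _.
by rewrite linearZ /= /tensr trmx_delta mul_delta_mx.
Qed.

Variables (C : 'I_m -> 'M[R]_m) (C' : 'I_n -> 'M[R]_n).

(* As rows are multiplied on the right, C i (x) C' j acts on 'M_(m, n) by
   X |-> (C i)^T X (C' j). *)
Definition tens_sc (q : 'I_(m * n)) : 'M[R]_(m * n) :=
  \sum_i \sum_j vec_mx (delta_mx 0 q) i j
    *: lin_mx (mulmxr (C' j) \o mulmx (C i)^T).

Lemma lmulmx_tens v : lmulmx tens_sc v =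
  \sum_i \sum_j vec_mx v i j *: lin_mx (mulmxr (C' j) \o mulmx (C i)^T).
Proof.
rewrite [in RHS](row_sum_delta v) /lmulmx /tens_sc.
under eq_bigr do rewrite scaler_sumr.
rewrite exchange_big; apply: eq_bigr => i _.
under eq_bigr do rewrite scaler_sumr.
rewrite exchange_big; apply: eq_bigr => j _.
rewrite linear_sum summxE scaler_suml; apply: eq_bigr => q _.
by rewrite scalerA; congr (_ *: _); rewrite !mxE.
Qed.

Lemma mulc_tens x y x' y' :
  mulc tens_sc (tensr x y) (tensr x' y') = tensr (mulc C x x') (mulc C' y y').
Proof.
rewrite /mulc lmulmx_tens mulmx_sumr -!/(mulc _ _ _) !mulcE linear_sumlz.
apply: eq_bigr => i _; rewrite mulmx_sumr linear_sumr; apply: eq_bigr => j _.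
rewrite -scalemxAr linearZl_LR linearZr_LR /= mul_vec_lin scalerA /= /tensr.
by rewrite mxvecK mxE big_ord1 mxE trmx_mul !mulmxA.
Qed.

End TensorSc.

Lemma map_tensr (R S : comNzRingType) (k : {rmorphism R -> S}) m n
    (x : 'rV[R]_m) (y : 'rV[R]_n) :
  map_mx k (tensr x y) = tensr (map_mx k x) (map_mx k y).
Proof. by rewrite /tensr map_mxvec map_mxM map_trmx. Qed.

Lemma map_tens_sc (R S : comNzRingType) (k : {rmorphism R -> S}) m n
    (C : 'I_m -> 'M[R]_m) (C' : 'I_n -> 'M[R]_n) q :
  map_mx k (tens_sc C C' q)
    = tens_sc (fun i => map_mx k (C i)) (fun i => map_mx k (C' i)) q.
Proof.
rewrite /tens_sc map_mx_sum; apply: eq_bigr => i _.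
rewrite map_mx_sum; apply: eq_bigr => j _.
rewrite map_mxZ -(map_delta_mx k) -map_vec_mx [in RHS]mxE; congr (_ *: _).
by apply: map_lin_mx => A /=; rewrite !map_mxM map_trmx.
Qed.

Section TensorUnital.
Variables (F : fieldType) (m n : nat) (C : 'I_m -> 'M[F]_m) (C' : 'I_n -> 'M[F]_n).
Variables (u : 'rV[F]_m) (u' : 'rV[F]_n).
Hypotheses (h : unital_sc C u) (h' : unital_sc C' u').

(** The laws are multilinear, so they are checked on pure tensors of basis vectors, where they hold
    factor by factor. *)
Lemma tens_unital : unital_sc (tens_sc C C') (tensr u u').
Proof.
split=> [x y z|x|x|].
- rewrite (tensr_sum x) !mulc_suml; apply: eq_bigr => i _.
  rewrite !mulc_suml; apply: eq_bigr => j _; rewrite !mulcZl; congr (_ *: _).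
  rewrite (tensr_sum y) !(mulc_suml, mulc_sumr); apply: eq_bigr => i' _.
  rewrite !(mulc_suml, mulc_sumr); apply: eq_bigr => j' _.
  rewrite !(mulcZl, mulcZr); congr (_ *: _).
  rewrite (tensr_sum z) !mulc_sumr; apply: eq_bigr => i2 _.
  rewrite !mulc_sumr; apply: eq_bigr => j2 _; rewrite !mulcZr; congr (_ *: _).
  by rewrite !mulc_tens (mulcA h) (mulcA h').
- rewrite {1}(tensr_sum x) mulc_sumr {2}(tensr_sum x); apply: eq_bigr => i _.
  rewrite mulc_sumr; apply: eq_bigr => j _.
  by rewrite mulcZr mulc_tens (mulc1l h) (mulc1l h').
- rewrite {1}(tensr_sum x) mulc_suml {2}(tensr_sum x); apply: eq_bigr => i _.
  rewrite mulc_suml; apply: eq_bigr => j _.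
  by rewrite mulcZl mulc_tens (mulc1r h) (mulc1r h').
have /rV0Pn[i ui] := mulc1_neq0 h; have /rV0Pn[j uj] := mulc1_neq0 h'.
apply/eqP => /(congr1 vec_mx); rewrite mxvecK linear0 => /matrixP/(_ i j).
by rewrite !mxE big_ord1 mxE => /eqP; rewrite mulf_eq0 (negbTE ui) (negbTE uj).
Qed.

End TensorUnital.

Section TensorProduct.
Variables (F : fieldType) (m n : nat) (C : 'I_m -> 'M[F]_m) (C' : 'I_n -> 'M[F]_n).
Variables (u : 'rV[F]_m) (u' : 'rV[F]_n).
Variables (A B T : algType F) (kA : coords A C u) (kB : coords B C' u').

Lemma bilinear_coords (M : lmodType F) (t : {bilinear A -> B -> M}) a b :
  t a b = \sum_i \sum_j vec_mx (tensr (to_rV kA a) (to_rV kB b)) i j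
    *: t (of_rV kA (delta_mx 0 i)) (of_rV kB (delta_mx 0 j)).
Proof.
have := row_sum_delta (to_rV kA a) => /(congr1 (of_rV kA)).
rewrite to_rVK (linear_sum (of_rV kA)) => {1}->; rewrite linear_sumlz.
have := row_sum_delta (to_rV kB b) => /(congr1 (of_rV kB)).
rewrite to_rVK (linear_sum (of_rV kB)) => bE.
apply: eq_bigr => i _; rewrite {1}bE linear_sumr; apply: eq_bigr => j _.
have ZA c v : of_rV kA (c *: v) = c *: of_rV kA v by rewrite linearZ.
have ZB c v : of_rV kB (c *: v) = c *: of_rV kB v by rewrite linearZ.
rewrite ZA ZB linearZl_LR linearZr_LR /=.
by rewrite scalerA /tensr mxvecK mxE big_ord1 mxE.
Qed.

(** The universal property gives the map from [T] to coordinates. Its inverse is defined on basis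
    tensors, and multiplicativity is checked on those. *)
Lemma tensor_product_coords (t : {bilinear A -> B -> T}) :
  tensor_product t -> inhabited (coords T (tens_sc C C') (tensr u u')).
Proof.
case=> univ t1 tM.
pose g a b := tensr (to_rV kA a) (to_rV kB b).
have g_bil : bilinear_for *:%R *:%R g.
  by split=> [b a x y|a b x y] /=; rewrite /g linearP ?linearPl ?linearPr.
pose gB := bilinear_isBilinear.Build F A B 'rV[F]_(m * n) _ _ g g_bil.
pose G : {bilinear A -> B -> 'rV[F]_(m * n)} := HB.pack g gB.
have [h hG _] := univ _ G.
have {}hG a b : h (t a b) = tensr (to_rV kA a) (to_rV kB b) by rewrite hG.
pose f (v : 'rV_(m * n)) := \sum_i \sum_j
  vec_mx v i j *: t (of_rV kA (delta_mx 0 i)) (of_rV kB (delta_mx 0 j)).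
have f_linear : linear f.
  move=> a x y; rewrite /f scaler_sumr -big_split; apply: eq_bigr => i _ /=.
  rewrite scaler_sumr -big_split; apply: eq_bigr => j _ /=.
  by rewrite linearP !mxE scalerDl scalerA.
pose fL := GRing.isLinear.Build F 'rV[F]_(m * n) T _ f f_linear.
pose f' : {linear 'rV[F]_(m * n) -> T} := HB.pack f fL.
have fK : cancel f' h.
  move=> v; rewrite /= /f linear_sum [RHS]tensr_sum; apply: eq_bigr => i _.
  rewrite linear_sum; apply: eq_bigr => j _.
  by rewrite linearZ /= hG !of_rVK.
have ft a b : f' (tensr (to_rV kA a) (to_rV kB b)) = t a b.
  by rewrite [RHS]bilinear_coords.
(* Both [f' \o h] and the identity factor [t] through itself, so they agree by uniqueness in the
   universal property. *)
have hK : cancel h f'.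
  have [h0 h0t h0u] := univ _ t => x.
  have idt := h0u (idfun : {linear T -> T}) (fun a b => erefl).
  rewrite -[RHS]/(idfun x) [RHS]idt -(h0u (f' \o h : {linear T -> T})) // => a b.
  by rewrite -[LHS]/(f' (h (t a b))) hG ft.
have f'M x y : f' (mulc (tens_sc C C') x y) = f' x * f' y.
  rewrite (tensr_sum x) (tensr_sum y) mulc_suml !linear_sum mulr_suml.
  apply: eq_bigr => i _; rewrite mulc_suml !linear_sum mulr_suml.
  apply: eq_bigr => j _; rewrite mulc_sumr !linear_sum mulr_sumr.
  apply: eq_bigr => i' _; rewrite mulc_sumr !linear_sum mulr_sumr.
  apply: eq_bigr => j' _; rewrite mulcZl mulcZr !linearZ -scalerAl -scalerAr.
  congr (_ *: (_ *: _)); rewrite mulc_tens.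
  by rewrite -[delta_mx 0 i](of_rVK kA) -[delta_mx 0 i'](of_rVK kA)
    -[delta_mx 0 j](of_rVK kB) -[delta_mx 0 j'](of_rVK kB) -!to_rVM !ft tM.
apply: inhabits; apply: (@Coords _ _ _ _ _ h f' hK fK) => [x y|].
  by apply: (can_inj fK); rewrite f'M !hK.
by rewrite -t1 hG !to_rV1.
Qed.

Lemma coords_tensor_product (kT : coords T (tens_sc C C') (tensr u u')) :
  exists t : {bilinear A -> B -> T}, tensor_product t.
Proof.
pose g a b := of_rV kT (tensr (to_rV kA a) (to_rV kB b)).
have g_bil : bilinear_for *:%R *:%R g.
  by split=> [b a x y|a b x y] /=; rewrite /g linearP ?linearPl ?linearPr linearP.
pose gB := bilinear_isBilinear.Build F A B T _ _ g g_bil.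
pose t : {bilinear A -> B -> T} := HB.pack g gB.
have Tsum x : x = \sum_i \sum_j vec_mx (to_rV kT x) i j
    *: t (of_rV kA (delta_mx 0 i)) (of_rV kB (delta_mx 0 j)).
  rewrite -[LHS](to_rVK kT) [to_rV kT x in LHS]tensr_sum linear_sum.
  apply: eq_bigr => i _; rewrite linear_sum; apply: eq_bigr => j _.
  by rewrite linearZ /= /g !of_rVK.
exists t; split=> [M s||a a' b b'].
- pose f x := \sum_i \sum_j vec_mx (to_rV kT x) i j
    *: s (of_rV kA (delta_mx 0 i)) (of_rV kB (delta_mx 0 j)).
  have f_linear : linear f.
    move=> a x y; rewrite /f scaler_sumr -big_split; apply: eq_bigr => i _ /=.
    rewrite scaler_sumr -big_split; apply: eq_bigr => j _ /=.
    by rewrite !linearP !mxE scalerDl scalerA.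
  pose fL := GRing.isLinear.Build F T M _ f f_linear.
  exists (HB.pack f fL : {linear T -> M}) => [a b|h' h's x] /=.
    by rewrite [RHS]bilinear_coords /f /= /g of_rVK.
  rewrite {1}(Tsum x) linear_sum /f; apply: eq_bigr => i _.
  by rewrite linear_sum; apply: eq_bigr => j _; rewrite linearZ h's.
- by rewrite /= /g !to_rV1 of_rV1.
- by rewrite /= /g -of_rVM mulc_tens !to_rVM.
Qed.

End TensorProduct.

Lemma eq_coords (F : fieldType) (A : algType F) n (C C' : 'I_n -> 'M[F]_n) u :
  C =1 C' -> coords A C u -> coords A C' u.
Proof.
move=> CC' k; apply: (Coords (to_rVK k) (of_rVK k) _ (to_rV1 k)) => x y.
by rewrite to_rVM /mulc /lmulmx; under eq_bigr do rewrite CC'.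
Qed.

Lemma eq_tens_sc (R : comNzRingType) m n (C1 C2 : 'I_m -> 'M[R]_m)
    (D1 D2 : 'I_n -> 'M[R]_n) :
  C1 =1 C2 -> D1 =1 D2 -> tens_sc C1 D1 =1 tens_sc C2 D2.
Proof.
by move=> hC hD q; apply: eq_bigr => i _; apply: eq_bigr => j _; rewrite hC hD.
Qed.

Lemma coords_alg_iso (F : fieldType) (A B : algType F) n (C : 'I_n -> 'M[F]_n) u :
  coords A C u -> coords B C u -> alg_iso A B.
Proof.
move=> kA kB; pose f := of_rV kB \o to_rV kA.
have fM : multiplicative f.
  by split=> [x y|]; rewrite /f /= ?to_rVM ?of_rVM // to_rV1 of_rV1.
pose fMM := GRing.isMultiplicative.Build A B f fM.
exists (HB.pack f fMM : {lrmorphism A -> B}).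
by exists (of_rV kA \o to_rV kB) => x; rewrite /= /f /= !(to_rVK, of_rVK).
Qed.

Lemma alg_iso_coords (F : fieldType) (A B : algType F) n (C : 'I_n -> 'M[F]_n) u :
  alg_iso A B -> coords B C u -> inhabited (coords A C u).
Proof.
move=> [f [g fK gK]] k; pose gL := GRing.isLinear.Build F B A _ g (can2_linear fK gK).
pose G : {linear B -> A} := HB.pack g gL.
have toK : cancel (to_rV k \o f) (G \o of_rV k) by move=> x; rewrite /= to_rVK fK.
have ofK : cancel (G \o of_rV k) (to_rV k \o f) by move=> x; rewrite /= gK of_rVK.
apply: inhabits; apply: (Coords toK ofK) => [x y|] /=.
  by rewrite rmorphM to_rVM.
by rewrite rmorph1 to_rV1.
Qed.

Lemma regular_coords (F : fieldType) :
  inhabited (@coords F F^o 1 (fun _ => 1%:M) 1%:M).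
Proof.
have to_lin : linear (fun x : F^o => x%:M : 'rV[F]_1).
  by move=> a x y; apply/rowP => i; rewrite !mxE ord1 !mulr1n.
have of_lin : linear (fun v : 'rV[F]_1 => v 0 0 : F^o).
  by move=> a x y; rewrite !mxE.
pose tL := GRing.isLinear.Build F F^o 'rV[F]_1 _ _ to_lin.
pose oL := GRing.isLinear.Build F 'rV[F]_1 F^o _ _ of_lin.
pose t : {linear F^o -> 'rV[F]_1} := HB.pack (fun x : F^o => x%:M : 'rV[F]_1) tL.
pose o : {linear 'rV[F]_1 -> F^o} := HB.pack (fun v : 'rV[F]_1 => v 0 0 : F^o) oL.
have toK : cancel t o by move=> x; rewrite /= mxE mulr1n.
have ofK : cancel o t by move=> v; rewrite /= -mx11_scalar.
apply: inhabits; apply: (Coords toK ofK) => // x y /=.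
by rewrite mulcE big_ord1 mulmx1 mxE mulr1n scale_scalar_mx.
Qed.

Fixpoint tpow_dim (d m : nat) : nat :=
  if m is m'.+1 then (tpow_dim d m' * d)%N else 1%N.

Fixpoint tpow_sc (R : comNzRingType) d (C : 'I_d -> 'M[R]_d) m :
    'I_(tpow_dim d m) -> 'M[R]_(tpow_dim d m) :=
  match m with
  | 0 => fun _ => 1%:M
  | m'.+1 => tens_sc (tpow_sc C (m := m')) C
  end.

Fixpoint tpow_one (R : comNzRingType) d (u : 'rV[R]_d) m : 'rV[R]_(tpow_dim d m) :=
  match m with
  | 0 => 1%:M
  | m'.+1 => tensr (tpow_one u m') u
  end.

Lemma map_tpow_sc (R S : comNzRingType) (k : {rmorphism R -> S}) d
    (C : 'I_d -> 'M[R]_d) m (q : 'I_(tpow_dim d m)) :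
  map_mx k (tpow_sc C q) = tpow_sc (fun i => map_mx k (C i)) q.
Proof.
elim: m q => [|m IH] q /=; first exact: map_mx1.
by rewrite map_tens_sc; apply: eq_tens_sc.
Qed.

Lemma map_tpow_one (R S : comNzRingType) (k : {rmorphism R -> S}) d
    (u : 'rV[R]_d) m :
  map_mx k (tpow_one u m) = tpow_one (map_mx k u) m.
Proof. by elim: m => [|m IH] /=; rewrite ?map_mx1 // map_tensr IH. Qed.

Section TensorPower.
Variables (F : fieldType) (d : nat) (C : 'I_d -> 'M[F]_d) (u : 'rV[F]_d).
Variables (A : algType F) (kA : coords A C u).

Lemma tpow_unital m : unital_sc (tpow_sc C (m := m)) (tpow_one u m).
Proof.
elim: m => [|m IH] /=; last exact: tens_unital IH (coords_unital kA).
by have [k] := regular_coords F; apply: (coords_unital k).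
Qed.

(** Makes the tensor power unique up to isomorphism. For the converse the lower tensor power has to
    be exhibited as an algebra, and [scalg] provides it. *)
Lemma tensor_powerP m (T : algType F) :
  tensor_power A m T <-> inhabited (coords T (tpow_sc C (m := m)) (tpow_one u m)).
Proof.
elim: m T => [|m IH] T.
  have [k] := regular_coords F; split=> [h|[k']]; first exact: (alg_iso_coords h k).
  exact: (coords_alg_iso k' k).
split=> [[T' [t [/IH[k'] ht]]]|[k]]; first exact: (tensor_product_coords k' kA ht).
have [t ht] := coords_tensor_product (scalg_coords (tpow_unital m)) kA k.
exists (scalg (tpow_unital m)), t; split=> //; apply/IH.
exact: (inhabits (scalg_coords _)).
Qed.

Lemma tensor_power_splitsP m : tensor_power_splits A m <->
  exists N, inhabited (coords 'M[F]_N.+1 (tpow_sc C (m := m)) (tpow_one u m)).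
Proof.
split=> [[T [/tensor_powerP[k] [N isoTM]]]|[N [k]]].
  exists N; have [f f_bij] := isoTM; apply: alg_iso_coords k.
  have [g fK gK] := f_bij.
  pose gM := GRing.isMultiplicative.Build _ _ g (can2_rmorphism fK gK).
  pose gL := GRing.isLinear.Build F _ _ _ g (can2_linear fK gK).
  by exists (HB.pack g gM gL : {lrmorphism 'M[F]_N.+1 -> T}); exists f.
exists 'M[F]_N.+1; split; first exact/tensor_powerP/inhabits.
by exists N; exists idfun; exists id.
Qed.

End TensorPower.

(** Row [i] of [P] is the flattened image of basis vector [i] under an isomorphism with the matrix
    algebra, and [Q] is the inverse of [P]; so the isomorphism is a solution of polynomial
    equations. *)
Definition matrix_basis (F : fieldType) n (C : 'I_n -> 'M[F]_n) (u : 'rV[F]_n) N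
    (P : 'M[F]_(n, N * N)) (Q : 'M[F]_(N * N, n)) : Prop :=
  [/\ forall i j, mxvec (vec_mx (row i P) *m vec_mx (row j P)) = row j (C i) *m P,
      u *m P = mxvec 1%:M, P *m Q = 1%:M & Q *m P = 1%:M].

Lemma matrix_basisP (F : fieldType) n (C : 'I_n -> 'M[F]_n) (u : 'rV[F]_n) N :
  inhabited (coords 'M[F]_N.+1 C u) <-> exists P Q, @matrix_basis F n C u N.+1 P Q.
Proof.
split=> [[k]|[P [Q [hM h1 PQ QP]]]].
  pose P := lin1_mx (mxvec \o of_rV k); pose Q := lin1_mx (to_rV k \o vec_mx).
  have PE v : v *m P = mxvec (of_rV k v) by rewrite mul_rV_lin1.
  have QE v : v *m Q = to_rV k (vec_mx v) by rewrite mul_rV_lin1.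
  exists P, Q; split=> [i j|||].
  - by rewrite -mulc_delta PE of_rVM (rowE i) (rowE j) !PE !mxvecK.
  - by rewrite PE of_rV1.
  - by apply/row_matrixP => i; rewrite !rowE mulmxA PE QE mxvecK of_rVK mulmx1.
  - by apply/row_matrixP => i; rewrite !rowE mulmxA QE PE to_rVK vec_mxK mulmx1.
have to_lin : linear (fun A : 'M[F]_N.+1 => mxvec A *m Q).
  by move=> a x y; rewrite linearP mulmxDl scalemxAl.
have of_lin : linear (fun v : 'rV[F]_n => vec_mx (v *m P)).
  by move=> a x y; rewrite mulmxDl -scalemxAl linearP.
pose tL := GRing.isLinear.Build F 'M[F]_N.+1 'rV[F]_n _ _ to_lin.
pose oL := GRing.isLinear.Build F 'rV[F]_n 'M[F]_N.+1 _ _ of_lin.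
pose t : {linear 'M[F]_N.+1 -> 'rV[F]_n} := HB.pack (fun A : 'M[F]_N.+1 => mxvec A *m Q) tL.
pose o : {linear 'rV[F]_n -> 'M[F]_N.+1} := HB.pack (fun v : 'rV[F]_n => vec_mx (v *m P)) oL.
have toK : cancel t o by move=> x; rewrite /= -mulmxA QP mulmx1 mxvecK.
have ofK : cancel o t by move=> v; rewrite /= vec_mxK -mulmxA PQ mulmx1.
have oM x y : o (mulc C x y) = o x * o y.
  rewrite (row_sum_delta x) (row_sum_delta y) mulc_suml !linear_sum mulr_suml.
  apply: eq_bigr => i _; rewrite mulc_sumr !linear_sum mulr_sumr.
  apply: eq_bigr => j _; rewrite mulcZl mulcZr !linearZ -scalerAl -scalerAr.
  congr (_ *: (_ *: _)); rewrite /= mulc_delta -hM mxvecK -!rowE.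
  by [].
apply: inhabits; apply: (Coords toK ofK) => [x y|].
  by apply: (can_inj ofK); rewrite oM !toK.
by rewrite /= -h1 -mulmxA PQ mulmx1.
Qed.

Section Transfer.
Variables (Z F1 F2 : fieldType) (k1 : {rmorphism Z -> F1}) (k2 : {rmorphism Z -> F2}).
Hypothesis hk : specializes k1 k2.

Lemma matrix_coords_transfer n (C : 'I_n -> 'M[Z]_n) (u : 'rV[Z]_n) N :
  inhabited (coords 'M[F1]_N.+1 (fun i => map_mx k1 (C i)) (map_mx k1 u)) ->
  inhabited (coords 'M[F2]_N.+1 (fun i => map_mx k2 (C i)) (map_mx k2 u)).
Proof.
case/matrix_basisP => P [Q [e1 e2 e3 e4]]; apply/matrix_basisP.
have [r hr hs] := hk (entries (fun _ : unit => P) ++ entries (fun _ : unit => Q)).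
have [|P' hP] := mxspec_exists1 hs (M := P).
  by move=> a; rewrite !mem_cat => ->.
have [|Q' hQ] := mxspec_exists1 hs (M := Q).
  by move=> a; rewrite !mem_cat => ->; rewrite ?orbT.
have hvec m q (A : 'M[F1]_(m, q)) A' : mxspec r A A' -> mxspec r (mxvec A) (mxvec A').
  by move=> hA i j; rewrite !ord1; case/mxvec_indexP: j => a b; rewrite !mxvecE.
have hrow i : mxspec r (vec_mx (row i P)) (vec_mx (row i P')).
  by move=> a b; rewrite !mxE.
have hC i : mxspec r (map_mx k1 (C i)) (map_mx k2 (C i)) by apply: mxspec_map.
have hu : mxspec r (map_mx k1 u) (map_mx k2 u) by apply: mxspec_map.
exists P', Q'; split=> [i j|||].
- apply: (mxspec_eq hr _ _ (e1 i j)); first exact/hvec/(mxspecM hr).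
  by apply: (mxspecM hr) => //; apply: mxspec_row.
- by apply: (mxspec_eq hr _ _ e2); [apply: (mxspecM hr) | apply/hvec/(mxspec1 hr)].
- by apply: (mxspec_eq hr _ _ e3); [apply: (mxspecM hr) | apply: (mxspec1 hr)].
- by apply: (mxspec_eq hr _ _ e4); [apply: (mxspecM hr) | apply: (mxspec1 hr)].
Qed.

Variables (d : nat) (C : 'I_d -> 'M[Z]_d) (u : 'rV[Z]_d).
Variables (A1 : algType F1) (A2 : algType F2).
Variables (K1 : coords A1 (fun i => map_mx k1 (C i)) (map_mx k1 u)).
Variables (K2 : coords A2 (fun i => map_mx k2 (C i)) (map_mx k2 u)).

Lemma tensor_power_splits_transfer m :
  tensor_power_splits A1 m -> tensor_power_splits A2 m.
Proof.
case/(tensor_power_splitsP K1) => N [k]; apply/(tensor_power_splitsP K2); exists N.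
have [|k'] := @matrix_coords_transfer _ (tpow_sc C (m := m)) (tpow_one u m) N.
  rewrite map_tpow_one; apply: inhabits; apply: eq_coords k => q.
  by rewrite map_tpow_sc.
rewrite map_tpow_one in k'; apply: inhabits; apply: eq_coords k' => q.
by rewrite map_tpow_sc.
Qed.

End Transfer.

(** The exponent depends only on which tensor powers split. *)
Lemma has_exponent_splits (F1 F2 : fieldType) (A1 : algType F1) (A2 : algType F2) :
  (forall m, tensor_power_splits A1 m <-> tensor_power_splits A2 m) ->
  forall n, has_exponent A1 n -> has_exponent A2 n.
Proof.
by move=> h n [n0 sn n_min]; split=> // [|m m0 /h]; [apply/h | apply: n_min].
Qed.

(** * The rational function field *)

Lemma fraction_denom (R : idomainType) (a : {fraction R}) :
  exists2 d : R, d != 0 & exists n, FracField.tofrac d * a = FracField.tofrac n.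
Proof.
elim/quotW: a => x; exists (x.2); first exact: denom_ratioP.
exists x.1; rewrite !piE; apply/eqmodP.
by rewrite /= FracField.equivfE /FracField.mulf !numden_Ratio ?mulf_neq0 ?oner_neq0
  ?denom_ratioP // !mulr1 mul1r mulrC.
Qed.

Lemma common_denom (R : idomainType) (s : seq {fraction R}) :
  exists2 d : R, d != 0 & forall a, a \in s ->
    exists n, FracField.tofrac d * a = FracField.tofrac n.
Proof.
elim: s => [|a s [d d0 hs]]; first by exists 1; rewrite ?oner_neq0.
have [e e0 [n en]] := fraction_denom a.
exists (d * e); first by rewrite mulf_neq0.
move=> b; rewrite inE => /orP[/eqP->|/hs[k hk]].
  by exists (d * n); rewrite rmorphM -mulrA en rmorphM.
by exists (k * e); rewrite rmorphM mulrAC hk rmorphM.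
Qed.

(** * Nonvanishing of polynomials over an infinite domain *)

Lemma infinite_uniq (T : eqType) : infinite T ->
  forall n, exists2 s : seq T, uniq s & size s = n.
Proof.
move=> T_inf; elim=> [|n [s us ss]]; first by exists [::].
have [x xs] : exists x, x \notin s.
  apply: NNPP => h; apply: T_inf; exists s => x.
  by apply: contraT => xs; case: h; exists x.
by exists (x :: s); rewrite /= ?xs ?us ?ss.
Qed.

Lemma poly_nonroot (R : idomainType) (p : {poly R}) : infinite R -> p != 0 ->
  exists x, p.[x] != 0.
Proof.
move=> R_inf p0; apply: NNPP => h.
have [s us ss] := infinite_uniq R_inf (size p).
have sp : all (root p) s.
  by apply/allP => x _; apply: contraT => px; case: h; exists x.
by have := max_poly_roots p0 sp us; rewrite ss ltnn.
Qed.

(** A monomial is determined by its last exponent and the remaining ones, so each coefficient of [p]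
    can be read off [muni p]. *)
Lemma muni_eq0 (R : nzRingType) n (p : {mpoly R[n.+1]}) : muni p = 0 -> p = 0.
Proof.
move=> p0; apply/mpolyP => m; rewrite mcoeff0.
pose rest (m : 'X_{1..n.+1}) := [multinom (m (widen_ord (leqnSn n) i) : nat) | i < n].
have rest_inj (a b : 'X_{1..n.+1}) : rest a = rest b -> a ord_max = b ord_max -> a = b.
  move=> /mnmP ab abm; apply/mnmP => i.
  case: (unliftP ord_max i) => [j ->|->] //.
  have := ab j; rewrite !mnmE; have -> // : widen_ord (leqnSn n) j = lift ord_max j.
  by apply: val_inj; rewrite /= /bump leqNgt ltn_ord.
have := congr1 (fun f : {poly {mpoly R[n]}} => f`_(m ord_max) @_(rest m)) p0.
rewrite muniE coef_sum raddf_sum /= coef0 mcoeff0 => <-.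
have [pm|pm] := boolP (m \in msupp p).
  rewrite (bigD1_seq m) ?msupp_uniq //= big1 ?addr0 => [|a am].
    by rewrite coefZ coefXn eqxx mulr1 mcoeffZ mcoeffX eqxx mulr1.
  rewrite coefZ coefXn; case: eqP => [em|]; last by rewrite mulr0 mcoeff0.
  rewrite mulr1 mcoeffZ mcoeffX; case: eqP => [er|]; last by rewrite mulr0.
  by case/eqP: am; apply: rest_inj.
rewrite big_seq big1 ?memN_msupp_eq0 // => a pa.
rewrite coefZ coefXn; case: eqP => [em|]; last by rewrite mulr0 mcoeff0.
rewrite mulr1 mcoeffZ mcoeffX; case: eqP => [er|]; last by rewrite mulr0.
by case/negP: pm; rewrite (rest_inj m a).
Qed.

(** Induction on the number of variables: a point [y] where the leading coefficient in the last
    variable does not vanish leaves a nonzero polynomial in one variable, which has a nonroot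
    [a]. *)
Lemma mpoly_nonroot (R : idomainType) n (p : {mpoly R[n]}) : infinite R -> p != 0 ->
  exists x, p.@[x] != 0.
Proof.
move=> R_inf; elim: n p => [|n IH] p p0.
  exists (fun _ => 0); rewrite (nvar0_mpolyC_eq p erefl) mevalC.
  apply: contraNneq p0 => p0; by rewrite (nvar0_mpolyC_eq p erefl) p0 mpolyC0.
have mp0 : muni p != 0 by apply: contraNneq p0 => /muni_eq0 ->.
have [y hy] : exists y, (lead_coef (muni p)).@[y] != 0 by apply: IH; rewrite lead_coef_eq0.
have [|a ha] := @poly_nonroot _ (map_poly (meval y) (muni p)) R_inf.
  apply: contraNneq hy => /(congr1 (fun f : {poly R} => f`_(size (muni p)).-1)).
  by rewrite coef_map coef0 => ->.
exists (fun i => if unlift ord_max i is Some j then y j else a).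
suff -> : p.@[fun i => if unlift ord_max i is Some j then y j else a]
    = (map_poly (meval y) (muni p)).[a] by [].
rewrite mevalE muniE rmorph_sum horner_sum; apply: eq_bigr => m _ /=.
rewrite map_polyZ map_polyXn hornerZ hornerXn /= mevalZ mevalX -mulrA.
rewrite big_ord_recr /= unlift_none; congr (_ * (_ * _)).
apply: eq_bigr => i _; rewrite mnmE.
have -> : widen_ord (leqnSn n) i = lift ord_max i.
  by apply: val_inj; rewrite /= /bump leqNgt ltn_ord.
by rewrite liftK.
Qed.

Section Specialization.
Variables (Z : fieldType) (q : nat).

Definition ratfun_const : {rmorphism Z -> ratfun Z q} :=
  (@FracField.tofrac {mpoly Z[q]}) \o (@mpolyC q Z).

(** The inclusion of constants is defined everywhere, so its graph serves every list. *)
Lemma const_specializes : specializes idfun ratfun_const.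
Proof.
move=> s; exists (fun a b => b = ratfun_const a).
  split=> //.
  - by move=> a _ b _ -> ->; rewrite rmorphD.
  - by move=> a _ ->; rewrite rmorphN.
  - by move=> a _ b _ -> ->; rewrite rmorphM.
  - by move=> a b b' -> ->.
by move=> a _; exists (ratfun_const a).
Qed.

Lemma eval_specializes : infinite Z -> specializes ratfun_const idfun.
Proof.
move=> Z_inf s; have [d d0 hd] := common_denom s.
have [x dx] := mpoly_nonroot Z_inf d0.
pose F (f : {mpoly Z[q]}) : ratfun Z q := FracField.tofrac f.
have F0 h : h.@[x] != 0 -> F h != 0.
  by apply: contraNneq => /eqP; rewrite tofrac_eq0 => /eqP->; rewrite meval0.
(* Evaluation on the local ring of the point [x]: [a] is a fraction [g / h] with [h] nonzero at [x],
   and [b] is its value. Denominators are multiplied out to avoid division. *)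
exists (fun a b => exists g h, [/\ h.@[x] != 0, F h * a = F g & h.@[x] * b = g.@[x]]).
  split.
  - move=> z; exists z%:MP, 1; rewrite meval1 oner_neq0 !mul1r mevalC; split=> //.
  - move=> a a' b b' [g [h [h0 ha ha']]] [g' [h' [h0' hb hb']]].
    exists (g * h' + g' * h), (h * h'); rewrite mevalM mulf_neq0 //; split=> //.
      by rewrite /F tofracM tofracD !tofracM -!/(F _) -ha -hb; ring.
    by rewrite mevalD !mevalM -ha' -hb'; ring.
  - move=> a a' [g [h [h0 ha ha']]]; exists (- g), h; split=> //.
      by rewrite mulrN ha /F tofracN.
    by rewrite mulrN ha' mevalN.
  - move=> a a' b b' [g [h [h0 ha ha']]] [g' [h' [h0' hb hb']]].
    exists (g * g'), (h * h'); rewrite mevalM mulf_neq0 //; split=> //.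
      by rewrite /F !tofracM mulrACA [X in X * _]ha [X in _ * X]hb.
    by rewrite mulrACA ha' hb' mevalM.
  move=> a b b' [g [h [h0 ha hb]]] [g' [h' [h0' ha' hb']]].
  (* Two representations of [a] agree after cross-multiplication in the polynomial ring, and this
     identity can be evaluated at [x]. *)
  have hg : g * h' = g' * h.
    apply/eqP; rewrite -tofrac_eq !tofracM -!/(F _) -ha -ha'; apply/eqP; ring.
  apply: (mulfI h0); apply: (mulfI h0'); rewrite hb mulrCA hb'.
  by move/(congr1 (meval x)): hg; rewrite !mevalM mulrC => ->; rewrite mulrC.
move=> a /hd[g hg]; exists (g.@[x] / d.@[x]); exists g, d; split=> //.
by rewrite mulrC divfK.
Qed.

End Specialization.

(** * The skewfield of fractions *)

Section SkewfieldCoords.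
Variables (Z : fieldType) (D : falgType Z) (q : nat).
Variables (DX : unitAlgType (ratfun Z q)) (j : {rmorphism {mpoly D[q]} -> DX}).
Hypothesis DX_frac : skewfield_of_fractions j.
Local Notation d := (dim D).
Local Notation k := (ratfun_const Z q).
Local Notation C := (fun i => map_mx k (@falg_sc Z D i)).
Local Notation u := (map_mx k (v2r (1 : D))).

Let e i : D := r2v (delta_mx 0 i).
Let S (v : 'rV[ratfun Z q]_d) : DX := \sum_i v 0 i *: j (e i)%:MP.

Let S_linear : linear S.
Proof.
move=> a x y; rewrite /S scaler_sumr -big_split; apply: eq_bigr => i _ /=.
by rewrite !mxE scalerDl scalerA.
Qed.
HB.instance Definition _ := GRing.isLinear.Build _ _ _ _ S S_linear.

Let scaleE (f : {mpoly Z[q]}) (y : DX) :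
  (FracField.tofrac f : ratfun Z q) *: y = y * j (map_mpoly (GRing.in_alg D) f).
Proof. by have [_ _ _ <-] := DX_frac; rewrite -scalerAr mulr1. Qed.

Let scale_const (a : Z) (y : D) : j (a *: y)%:MP = k a *: j y%:MP.
Proof.
by rewrite [RHS]scaleE map_mpolyC -rmorphM -mpolyCM /= -scalerAr mulr1.
Qed.

Let S_const (y : D) : S (map_mx k (v2r y)) = j y%:MP.
Proof.
rewrite -[y in RHS]v2rK [v2r y in RHS]row_sum_delta linear_sum /=.
rewrite (raddf_sum (@mpolyC q D)) rmorph_sum /= /S; apply: eq_bigr => i _.
by rewrite mxE linearZ scale_const.
Qed.

Let S_delta i : S (delta_mx 0 i) = j (e i)%:MP.
Proof. by rewrite -S_const r2vK map_delta_mx. Qed.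

Let SM x y : S (mulc C x y) = S x * S y.
Proof.
rewrite (row_sum_delta x) (row_sum_delta y) mulc_suml !linear_sum mulr_suml.
apply: eq_bigr => i _; rewrite mulc_sumr linear_sum mulr_sumr.
apply: eq_bigr => i' _; rewrite mulcZl mulcZr !linearZ /= -scalerAl -scalerAr.
rewrite mulc_delta !S_delta -rmorphM -mpolyCM -map_row rowK S_const.
by [].
Qed.

Let S_one : S u = 1.
Proof. by rewrite S_const mpolyC1 rmorph1. Qed.

(** After clearing denominators the relation lives in D[X] because [j] is injective. Each monomial
    then gives a linear relation over Z between the basis vectors of [D]. *)
Let S_inj v : S v = 0 -> v = 0.
Proof.
move=> Sv; have [s s0 hs] := common_denom (codom (v 0)).
have /fin_all_exists[g hg] i : exists g, FracField.tofrac s * v 0 i = FracField.tofrac g.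
  by apply: hs; apply: codom_f.
have [_ j_inj _ _] := DX_frac.
have sum0 : \sum_i (e i)%:MP * map_mpoly (GRing.in_alg D) (g i) = 0.
  apply: j_inj; rewrite rmorph0 rmorph_sum /=.
  transitivity ((FracField.tofrac s : ratfun Z q) *: S v); last by rewrite Sv scaler0.
  rewrite /S scaler_sumr; apply: eq_bigr => i _.
  by rewrite scalerA hg scaleE rmorphM.
have g0 i : g i = 0.
  apply/mpolyP => m; rewrite mcoeff0.
  have : \sum_i (g i)@_m *: e i = 0.
    have := congr1 (mcoeff m) sum0; rewrite mcoeff0 raddf_sum => h0.
    rewrite -[RHS]h0.
    apply: eq_bigr => l _; rewrite /= mcoeffCM mcoeff_map_mpoly /=.
    by rewrite -scalerAr mulr1.
  move=> h; have /(can_inj r2vK)/rowP/(_ i) : r2v (\row_i (g i)@_m) = r2v 0 :> D.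
    rewrite [RHS]linear0 -[RHS]h [\row_i _]row_sum_delta linear_sum; apply: eq_bigr => l _.
    by rewrite linearZ mxE.
  by rewrite !mxE.
apply/rowP => i; have := hg i; rewrite g0 tofrac0 mxE => /eqP.
by rewrite mulf_eq0 tofrac_eq0 (negbTE s0) => /eqP.
Qed.

Let S_poly (f : {mpoly D[q]}) : exists v, S v = j f.
Proof.
exists (\sum_(m <- msupp f) (FracField.tofrac 'X_[m] : ratfun Z q)
  *: map_mx k (v2r f@_m)).
rewrite linear_sum [f in RHS]mpolyE rmorph_sum; apply: eq_bigr => m _.
rewrite linearZ /= S_const scaleE -rmorphM; congr (j _).
rewrite -mul_mpolyC; congr (_ * _).
by apply/mpolyP => m'; rewrite mcoeff_map_mpoly !mcoeffX /= scaler_nat.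
Qed.

(** The image of [S] contains D[X], and it is closed under inverses of nonzero elements [j b]:
    multiplication by [j b] is injective on a finite-dimensional space, hence surjective, so the
    unit is reached. *)
Let S_surj x : exists v, S v = x.
Proof.
have [DX_div j_inj hfrac _] := DX_frac.
have [a [b [b0 ->]]] := hfrac x; have [va <-] := S_poly a; have [vb hb] := S_poly b.
have jb0 : j b != 0 by rewrite -(rmorph0 j) (inj_eq j_inj).
have free : row_free (lmulmx C vb).
  apply: inj_row_free => v hv; apply: S_inj; apply: (mulrI (DX_div _ jb0)).
  by rewrite mulr0 -hb -SM /mulc hv linear0.
have /row_fullP[M hM] : row_full (lmulmx C vb) by rewrite row_full_unit -row_free_unit.
exists (mulc C va (u *m M)); rewrite SM; congr (_ * _).
apply: (mulrI (DX_div _ jb0)); rewrite divrr ?DX_div // -hb -SM /mulc -mulmxA.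
by rewrite hM mulmx1 S_one.
Qed.

Lemma skewfield_coords : inhabited (coords DX C u).
Proof.
pose T x := sval (sig_eqW (S_surj x)).
have TK : cancel T S by move=> x; rewrite /T; case: sig_eqW.
have SK : cancel S T.
  by move=> v; apply/eqP; rewrite -subr_eq0; apply/eqP/S_inj; rewrite linearB /= TK subrr.
pose TL := GRing.isLinear.Build _ _ _ _ T (can2_linear SK TK).
pose T' : {linear DX -> 'rV[ratfun Z q]_d} := HB.pack T TL.
apply: inhabits; apply: (@Coords _ DX _ C u T' S TK SK) => [x y|].
  by apply: (can_inj SK); rewrite SM /= !TK.
by rewrite /= -S_one SK.
Qed.

End SkewfieldCoords.

(** * Dimension over the centre and comparison of [D] with [DX] *)

Lemma coords_has_dim (F : fieldType) (A : algType F) n (C : 'I_n -> 'M[F]_n) u :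
  coords A C u -> has_dim A n.
Proof.
move=> k; exists (fun i => of_rV k (delta_mx 0 i)) => v.
have of_sum (c : {ffun 'I_n -> F}) :
    \sum_i c i *: of_rV k (delta_mx 0 i) = of_rV k (\row_i c i).
  rewrite [X in of_rV k X]row_sum_delta linear_sum.
  by apply: eq_bigr => i _; rewrite linearZ mxE.
exists [ffun i => to_rV k v 0 i]; split=> [|c ->].
  rewrite of_sum; apply: (can_inj (to_rVK k)); rewrite of_rVK.
  by apply/rowP => i; rewrite mxE ffunE.
by apply/ffunP => i; rewrite ffunE of_sum of_rVK mxE.
Qed.

Theorem theorem1p2p5 (Z : fieldType) (Z_infinite : infinite Z)
    (D : falgType Z) (D_div : division_ring D)
    (D_centre : ('Z({:D}) = 1)%VS)
    (q : nat) (DX : unitAlgType (ratfun Z q))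
    (j : {rmorphism {mpoly D[q]} -> DX})
    (DX_frac : skewfield_of_fractions j) :
  [/\ has_dim DX (\dim {:D})
        /\ (forall n, has_exponent DX n <-> has_exponent D n),
      has_maximal_subfield (@galois_subfield _ DX)
        <-> has_maximal_subfield (@galois_subfield _ D)
    & forall p, p \in [pchar Z] -> forall r,
        (has_maximal_subfield (@purely_insep_subfield p r _ DX)
           <-> has_maximal_subfield (@purely_insep_subfield p r _ D))
        /\ (has_maximal_subfield (@elem_galois_subfield p r _ DX)
           <-> has_maximal_subfield (@elem_galois_subfield p r _ D))].
Proof.
have [kX] := skewfield_coords DX_frac.
(* The coordinates of [D] are rewritten along the identity, so that [D] and [DX] have the form
   required by the transfer lemmas, with the same constants over Z. *)
have kD : coords D (fun i => map_mx idfun (falg_sc (A := D) i)) (map_mx idfun (v2r 1)).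
  by rewrite map_mx_id //; apply: (eq_coords _ (falg_coords D)) => i; rewrite map_mx_id.
have [DX_div _ _ _] := DX_frac.
have up := @const_specializes Z q; have down := @eval_specializes Z q Z_infinite.
have galT gT : has_maximal_subfield (@galois_group_subfield gT _ DX) <->
    has_maximal_subfield (@galois_group_subfield gT _ D).
  by split; [apply: (galois_group_transfer down kX kD)
            | apply: (galois_group_transfer up kD kX)].
split.
- split; first by rewrite dimvf; apply: coords_has_dim kX.
  have splits m : tensor_power_splits DX m <-> tensor_power_splits D m.
    by split; [apply: (tensor_power_splits_transfer down kX kD)
              | apply: (tensor_power_splits_transfer up kD kX)].
  by move=> n; split; apply: has_exponent_splits => m; rewrite splits.
- split=> /galois_subfieldP[gT h]; apply/galois_subfieldP; exists gT; exact/galT.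
(* [elem_galois_subfield] unfolds to [galois_group_subfield] for the additive group of row vectors
   over ['Z_p]. *)
move=> p p_char r; split; last exact: galT.
by split; [apply: (purely_insep_transfer down kX kD)
          | apply: (purely_insep_transfer up kD kX)].
Qed.
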